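(* Let $F/\mathbb{F}_q$ be an algebraic function field of one variable with full constant field $\mathbb{F}_q$, and let $P_1$ and $P_2$ be two distinct rational places of $F$. Then the set $G_0(P_1,P_2)$ of pure gaps at $P_1,P_2$ is given by $$G_0(P_1,P_2)=\{\mathrm{glb}(\mathbf{x},\mathbf{y})\mid \mathbf{x},\mathbf{y}\in\Gamma(P_1,P_2)\}\setminus\Gamma(P_1,P_2).$$
   Context: $\mathbb{N}=\{0,1,2,\dots\}$. A place is rational if it has degree one. For a divisor $D$ of $F$, $\ell(D)$ is the dimension over the constant field of the Riemann-Roch space $\mathcal{L}(D)=\{z\in F: (z)+D\ge 0\}\cup\{0\}$. $(z)_\infty$ denotes the pole divisor of $z$. For a rational place $P$: $H(P)=\{s\in\mathbb{N}\mid (z)_\infty=sP \text{ for some } z\in F\}$ and $G(P)=\mathbb{N}\setminus H(P)$ (the gaps at $P$). For two distinct rational places: $H(P_1,P_2)=\{(s_1,s_2)\in\mathbb{N}^2\mid (z)_\infty=s_1P_1+s_2P_2\text{ for some }z\in F\}$. Minimal generating set: for $\beta\in G(P_1)$ let $n_\beta=\min\{\gamma\in\mathbb{N}\mid(\beta,\gamma)\in H(P_1,P_2)\}$. It is known that $\beta\mapsto n_\beta$ is a bijection $G(P_1)\to G(P_2)$. The minimal generating set is its graph $\Gamma(P_1,P_2)=\{(\beta,n_\beta)\mid\beta\in G(P_1)\}$. Pure gaps: $(s_1,s_2)\in\mathbb{N}^2$ is a pure gap at $P_1,P_2$ if $\ell(s_1P_1+s_2P_2)=\ell(s_1P_1+s_2P_2-P_j)$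 for both $j=1$ and $j=2$; $G_0(P_1,P_2)$ is the set of pure gaps. For $\mathbf{x}=(\beta_1,\gamma_1)$ and $\mathbf{y}=(\beta_2,\gamma_2)$ in $\mathbb{N}^2$, $\mathrm{glb}(\mathbf{x},\mathbf{y})=(\min\{\beta_1,\beta_2\},\min\{\gamma_1,\gamma_2\})$. *)

(* Defs.v *)
From HB Require Import structures.
From mathcomp Require Import all_boot all_order all_algebra.
From mathcomp Require Import boolp classical_sets.
From mathcomp.multinomials Require Import freeg.

Set Implicit Arguments.
Unset Strict Implicit.
Unset Printing Implicit Defensive.

Import Order.TTheory GRing.Theory Num.Theory.
Local Open Scope classical_set_scope.
Local Open Scope ring_scope.

(* A field extension F/K is an embedding [iota : {rmorphism K -> F}]: MathComp's
   [fieldExtType] is restricted to finite extensions. *)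

(* The subfield K(x) of F. *)
Definition simple_ext (K F : fieldType) (iota : {rmorphism K -> F}) (x : F) :
    set F :=
  [set z | exists p q : {poly K},
     (map_poly iota q).[x] != 0 /\
     z = (map_poly iota p).[x] / (map_poly iota q).[x]].

(* F is a finite extension of K(x) for some x transcendental over K. *)
Definition function_field (K F : fieldType) (iota : {rmorphism K -> F}) : Prop :=
  exists x : F, ~ algebraicOver iota x /\
    exists (n : nat) (e : 'I_n -> F), forall z : F,
      exists c : 'I_n -> F,
        (forall i, simple_ext iota x (c i)) /\ z = \sum_(i < n) c i * e i.

Definition full_constant_field (K F : fieldType) (iota : {rmorphism K -> F}) :
    Prop :=
  forall z : F, algebraicOver iota z -> exists a : K, z = iota a.

(* For K-subspaces W <= V of F, the classes of b_0, ..., b_(n-1) form a K-basis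
   of V / W. *)
Definition quotient_basis (K F : fieldType) (iota : {rmorphism K -> F})
    (V W : set F) (n : nat) (b : 'I_n -> F) : Prop :=
  [/\ forall i, V (b i),
      forall c : 'I_n -> K,
        W (\sum_(i < n) iota (c i) * b i) -> forall i, c i = 0
    & forall z, V z ->
        exists c : 'I_n -> K, W (z - \sum_(i < n) iota (c i) * b i)].

(* dim_K (V / W), with the convention 0 when it is infinite. *)
Definition quotient_dim (K F : fieldType) (iota : {rmorphism K -> F})
    (V W : set F) : nat :=
  xget 0%N [set n | exists b : 'I_n -> F, quotient_basis iota V W b].

(* A place is the maximal ideal of a valuation ring O of F/K, that is, of a ring
   K < O < F (strict inclusions) such that z \in O or z^-1 \in O for all z.  Since
   the ideal and the ring determine each other, a place is encoded by O. *)
Record place (K F : fieldType) (iota : {rmorphism K -> F}) := Place {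
  val_ring : set F;
  val_ring_const : forall a : K, val_ring (iota a);
  val_ringB : forall y z, val_ring y -> val_ring z -> val_ring (y - z);
  val_ringM : forall y z, val_ring y -> val_ring z -> val_ring (y * z);
  val_ring_neqK : exists2 z, val_ring z & forall a : K, z <> iota a;
  val_ring_neqF : exists z, ~ val_ring z;
  val_ring_total : forall z, val_ring z \/ val_ring z^-1 }.

HB.instance Definition _ (K F : fieldType) (iota : {rmorphism K -> F}) :=
  gen_eqMixin (place iota).
HB.instance Definition _ (K F : fieldType) (iota : {rmorphism K -> F}) :=
  gen_choiceMixin (place iota).

Section Places.

Context (K F : fieldType) (iota : {rmorphism K -> F}).
Implicit Types (P Q : place iota) (z t u : F) (D : {freeg place iota}).

Definition val_units P : set F := [set u | [/\ u != 0, val_ring P u & val_ring P u^-1]].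

Definition max_ideal P : set F := val_ring P `\` val_units P.

Definition place_degree P : nat := quotient_dim iota (val_ring P) (max_ideal P).

Definition rational P : Prop := place_degree P = 1%N.

Definition prime_element P t : Prop := max_ideal P = [set t * y | y in val_ring P].

(* v_P(z) is the n such that z = t^n u with t a prime element and u a unit at P;
   it is only used for z != 0 (the value at 0, mathematically +oo, is junk). *)
Definition valuation P z : int :=
  xget 0 [set n : int | exists t u,
    [/\ prime_element P t, val_units P u & z = t ^ n * u]].

(* Divisors are the elements of {freeg place iota}, the free abelian group on the
   places; [coeff Q D] is the multiplicity of D at Q. *)

Definition RR_space D : set F :=
  [set z | z = 0 \/ forall Q, 0 <= valuation Q z + coeff Q D].

Definition ell D : nat := quotient_dim iota (RR_space D) [set 0].

(* (z)_oo = D *)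
Definition pole_divisor_is z D : Prop :=
  z != 0 /\ forall Q, coeff Q D = Num.max 0 (- valuation Q z).

Definition weierstrass1 P : set nat :=
  [set s | exists z, pole_divisor_is z (<< P >> *+ s)].

Definition gaps1 P : set nat := ~` weierstrass1 P.

Definition weierstrass2 P1 P2 : set (nat * nat) :=
  [set s | exists z, pole_divisor_is z (<< P1 >> *+ s.1 + << P2 >> *+ s.2)].

(* n_beta, the least gamma such that (beta, gamma) \in H(P1, P2) *)
Definition least_partner P1 P2 (beta : nat) : nat :=
  xget 0%N [set c : nat | weierstrass2 P1 P2 (beta, c) /\
    forall c' : nat, weierstrass2 P1 P2 (beta, c') -> (c <= c')%N].

Definition min_gen_set P1 P2 : set (nat * nat) :=
  [set (beta, least_partner P1 P2 beta) | beta in gaps1 P1].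

Definition pure_gaps P1 P2 : set (nat * nat) :=
  [set s | let D : {freeg place iota} := << P1 >> *+ s.1 + << P2 >> *+ s.2 in
    ell D = ell (D - << P1 >>) /\ ell D = ell (D - << P2 >>)].

End Places.

Definition glb (x y : nat * nat) : nat * nat := (minn x.1 y.1, minn x.2 y.2).

(* Main.v *)
From mathcomp.multinomials Require Import freeg.
Require Import Defs.
From mathcomp Require Import all_boot all_order all_algebra.
From mathcomp Require Import boolp classical_sets.
From mathcomp Require cardinality.
From mathcomp Require Import ring zify.

(** Write H for the set of pairs (a, b) such that some function has pole divisor
    a P1 + b P2, and n_a for the least b with (a, b) in H.

    The identity itself is a statement about H alone [pure_glb_iff].  It uses
    three properties of H.
    - Subtracting P_j from the divisor s P1 + t P2 leaves the Riemann-Roch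
      dimension unchanged exactly when no function of the larger space attains
      the allowed pole order there.  So (s, t) is a pure gap if and only if H
      contains no (s, b) with b <= t and no (a, t) with a <= s [pure_gapsE].
    - At a rational place, of two functions with the same pole order at P1 but
      different ones at P2, a constant multiple of one can be subtracted from
      the other, which lowers the order at P1 and keeps the larger order at P2
      [weierstrass2_cancel].
    - Every row and every column of H is inhabited [weierstrass2_exists].
    If (s, t) is a pure gap, then t < n_s, and for the least b with (b, t) in H
    one has s < b and n_b = t by cancellation; hence (s, t) is the greatest
    lower bound of (s, n_s) and (b, n_b).  Conversely such a bound outside of
    the graph comes, up to the order of its arguments, from gaps a < b with
    n_b < n_a, and it is (a, n_b): minimality of n_a excludes (a, c) with
    c <= n_b, and a pair (c, n_b) in H with c <= a would cancel against (b, n_b)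
    and contradict the minimality of n_b.

    The rest of the file supplies the function field theory.  Most of it rests on
    one finiteness statement: for each z in F there is an N such that any N
    elements of F satisfy a nontrivial linear relation with coefficients in K[z]
    [dependence_bound_exists].  It follows by counting dimensions over K.  From
    it one gets:
    - places are discrete, since a long chain of elements of decreasing
      valuation would be independent over K[z] [no_infinite_chain];
    - a nonzero function has finitely many zeros, since functions that separate
      its zeros are independent [finite_zeros];
    - localization at a zero P of y can be done inside the ring of functions
      that are regular wherever y is [local_denominator];
    - there is a nonconstant function with poles only at P [exists_single_pole].
      This replaces Riemann's inequality.  Let x have a pole at P and let n be
      the rank of F over K(x).  The functions with poles bounded by m times the
      poles of x have dimension at least n (m - c), while lowering the bound by
      one at all poles other than P costs at most n - 1.
    With the last three points a function with prescribed pole order at P1, and no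
    other poles outside of P2, is written down directly [exists_pole_order].
    Finally, an element that is regular everywhere is constant, because a
    transcendental one has a pole by Zorn's lemma [exists_place_pole]; this
    makes the Riemann-Roch spaces finite-dimensional. *)

Set Implicit Arguments.
Unset Strict Implicit.
Unset Printing Implicit Defensive.

Import Order.TTheory GRing.Theory Num.Theory.
Local Open Scope classical_set_scope.
Local Open Scope ring_scope.

(** * Linear algebra over the constant field *)

Section LinearAlgebra.

Context (K F : fieldType) (iota : {rmorphism K -> F}).
Implicit Types (V W U : set F).

(** The coefficient matrix has more rows than columns, so it has a nonzero
    left kernel vector; its entries are the coefficients of the relation. *)
Lemma card_lt_dependent (I J : finType) (f : I -> F) (b : J -> F) :
    (#|J| < #|I|)%N ->
    (forall i, exists c : J -> K, f i = \sum_j iota (c j) * b j) ->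
  exists c : I -> K, (exists i, c i != 0) /\ \sum_i iota (c i) * f i = 0.
Proof.
move=> ltJI /choice[A fA].
pose M := \matrix_(i < #|I|, j < #|J|) A (enum_val i) (enum_val j).
have : kermx M != 0.
  rewrite kermx_eq0 /row_free; apply: contraTneq ltJI => <-.
  by rewrite -leqNgt rank_leq_col.
case/rowV0Pn => v /sub_kermxP vM /rV0Pn[k vk].
exists (fun i => v 0 (enum_rank i)); split.
  by exists (enum_val k); rewrite enum_valK.
under eq_bigr => i _ do rewrite fA mulr_sumr.
rewrite exchange_big big1 //= => j _.
under eq_bigr => i _ do rewrite mulrA -rmorphM.
rewrite -mulr_suml -rmorph_sum /=.
have /matrixP/(_ 0 (enum_rank j)) := vM; rewrite !mxE => vMj.
rewrite (reindex (enum_val : 'I_#|I| -> I)) /=; last exact/onW_bij/enum_val_bij.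
under eq_bigr => i _ do rewrite enum_valK.
suff -> : \sum_(i < #|I|) v 0 i * A (enum_val i) j = 0 by rewrite rmorph0 mul0r.
by rewrite -[RHS]vMj; apply: eq_bigr => i _; rewrite mxE enum_rankK.
Qed.

Definition subspace W : Prop :=
  W 0 /\ forall a u v, W u -> W v -> W (iota a * u + v).

Lemma subspace_scale W a u : subspace W -> W u -> W (iota a * u).
Proof. by move=> [W0 WD] Wu; rewrite -[_ * _]addr0; apply: WD. Qed.

Lemma subspaceD W u v : subspace W -> W u -> W v -> W (u + v).
Proof. by move=> [W0 WD] Wu Wv; have := WD 1 _ _ Wu Wv; rewrite rmorph1 mul1r. Qed.

Lemma subspaceB W u v : subspace W -> W u -> W v -> W (u - v).
Proof.
by move=> [W0 WD] Wu Wv; have := WD (-1) _ _ Wv Wu; rewrite rmorphN1 mulN1r addrC.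
Qed.

Lemma subspace_sum W (I : finType) (c : I -> K) (f : I -> F) :
  subspace W -> (forall i, W (f i)) -> W (\sum_i iota (c i) * f i).
Proof.
move=> sW Wf; apply: (big_ind W); first by case: sW.
  by move=> u v; apply: subspaceD.
by move=> i _; apply: subspace_scale.
Qed.

Lemma subspace0 : subspace [set 0].
Proof. by split=> // a u v -> ->; rewrite mulr0 addr0. Qed.

Definition extend (m : nat) (f : 'I_m -> F) (z : F) (i : 'I_m.+1) : F :=
  if unlift ord_max i is Some j then f j else z.

Lemma extend_in V m (f : 'I_m -> F) z :
  (forall i, V (f i)) -> V z -> forall i, V (extend f z i).
Proof. by move=> Vf Vz i; rewrite /extend; case: unliftP. Qed.

Lemma extend_sum m (f : 'I_m -> F) z (c : 'I_m.+1 -> K) :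
  \sum_i iota (c i) * extend f z i =
  \sum_(j < m) iota (c (lift ord_max j)) * f j + iota (c ord_max) * z.
Proof.
rewrite big_ord_recr /= /extend unlift_none; congr (_ + _).
apply: eq_bigr => j _.
have -> : widen_ord (leqnSn m) j = lift ord_max j.
  by apply: val_inj; rewrite /= /bump leqNgt ltn_ord.
by rewrite liftK.
Qed.

(** Solves the relation for the last member [z]: this is how a dependent
    family with nonzero last coefficient expresses [z] by the others. *)
Lemma extend_solve m (f : 'I_m -> F) z (c : 'I_m.+1 -> K) : c ord_max != 0 ->
  z - \sum_(j < m) iota (- (c ord_max)^-1 * c (lift ord_max j)) * f j =
  iota (c ord_max)^-1 *
    (\sum_(j < m) iota (c (lift ord_max j)) * f j + iota (c ord_max) * z).
Proof.
move=> cn0.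
rewrite mulrDr mulrA -rmorphM mulVf // rmorph1 mul1r addrC mulr_sumr -sumrN.
congr (_ + _); apply: eq_bigr => j _.
by rewrite rmorphM rmorphN !mulNr opprK mulrA.
Qed.

(** A maximal family that is independent modulo [W] is a basis of [V] modulo
    [W]; the hypothesis bounds its length by [n]. *)
Lemma dependent_basis V W n : subspace W ->
    (forall f : 'I_n.+1 -> F, (forall i, V (f i)) ->
       exists c : 'I_n.+1 -> K,
         (exists i, c i != 0) /\ W (\sum_i iota (c i) * f i)) ->
  exists (m : nat) (b : 'I_m -> F), (m <= n)%N /\ quotient_basis iota V W b.
Proof.
move=> sW dep.
pose indep m := exists f : 'I_m -> F, (forall i, V (f i)) /\
  forall c : 'I_m -> K, W (\sum_i iota (c i) * f i) -> forall i, c i = 0.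
have [m [le_mn ind_m nind]] : exists m, [/\ (m <= n)%N, indep m & ~ indep m.+1].
  apply: contrapT => noM.
  have allm : forall m, (m <= n.+1)%N -> indep m.
    elim=> [_|m IH le_mn]; first by exists (fun=> 0); split=> [[]|c _ []].
    apply: contrapT => nind; apply: noM; exists m; split=> //.
    exact/IH/ltnW.
  have [f [Vf find]] := allm _ (leqnn _).
  have [c [[i ci] Wc]] := dep f Vf.
  by rewrite (find c Wc i) eqxx in ci.
have [f [Vf find]] := ind_m.
exists m, f; split=> //; split=> // z Vz.
apply: contrapT => noz; apply: nind.
exists (extend f z); split=> [i|c]; first exact: extend_in.
rewrite extend_sum; have [c0|cn0] := eqVneq (c ord_max) 0.
  rewrite c0 rmorph0 mul0r addr0 => /find cl i.
  by case: (unliftP ord_max i) => [j ->|->] //; apply: cl.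
move=> Wc; exfalso; apply: noz.
exists (fun j => - (c ord_max)^-1 * c (lift ord_max j)).
rewrite extend_solve //; exact: subspace_scale.
Qed.

(** Dimension of V / W at most n, expressed by spanning vectors that may lie
    outside of V, so that the property passes to subsets of V. *)
Definition codim_le V W n : Prop :=
  exists (J : finType) (b : J -> F), (#|J| <= n)%N /\
    forall z, V z -> exists c : J -> K, W (z - \sum_j iota (c j) * b j).

Lemma codim_le_trans V W U m n :
  codim_le V W m -> codim_le W U n -> codim_le V U (m + n).
Proof.
move=> [I [a [leI aP]]] [J [b [leJ bP]]].
exists (I + J)%type, (fun k => match k with inl i => a i | inr j => b j end).
split; first by rewrite card_sum leq_add.
move=> z /aP[c /bP[d Ud]].
exists (fun k => match k with inl i => c i | inr j => d j end).
by rewrite big_sumType /= opprD addrA.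
Qed.

Lemma codim_leS V V' W n : V' `<=` V -> codim_le V W n -> codim_le V' W n.
Proof. by move=> VV' [J [b [leJ bP]]]; exists J, b; split=> // z /VV'/bP. Qed.

Lemma codim_le_dependent V n (I : finType) (f : I -> F) :
    codim_le V [set 0] n -> (n < #|I|)%N -> (forall i, V (f i)) ->
  exists c : I -> K, (exists i, c i != 0) /\ \sum_i iota (c i) * f i = 0.
Proof.
move=> [J [b [leJ bP]]] ltI Vf.
apply: (@card_lt_dependent I J f b); first exact: leq_ltn_trans ltI.
by move=> i; have [c /= /subr0_eq] := bP _ (Vf i); exists c.
Qed.

Lemma dependent_codim_le V W n : subspace W ->
    (forall f : 'I_n.+1 -> F, (forall i, V (f i)) ->
       exists c : 'I_n.+1 -> K,
         (exists i, c i != 0) /\ W (\sum_i iota (c i) * f i)) ->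
  codim_le V W n.
Proof.
move=> sW /(dependent_basis sW)[m [b [le_mn [_ _ bP]]]].
by exists 'I_m, b; rewrite card_ord.
Qed.

Lemma codim_le_basis V n : codim_le V [set 0] n ->
  exists (m : nat) (b : 'I_m -> F), quotient_basis iota V [set 0] b.
Proof.
move=> Vn; have [|m [b [_ bP]]] := @dependent_basis V [set 0] n subspace0.
  by move=> f /(codim_le_dependent Vn); apply; rewrite card_ord.
by exists m, b.
Qed.

Lemma quotient_dim_basis V n : codim_le V [set 0] n ->
  exists b : 'I_(quotient_dim iota V [set 0]) -> F,
    quotient_basis iota V [set 0] b.
Proof.
move=> /codim_le_basis[m [b bP]].
by apply: (xgetPex 0%N (P := [set n | exists b : 'I_n -> F,
  quotient_basis iota V [set 0] b])); exists m, b.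
Qed.

(** A subspace of a finite-dimensional space that has the same dimension is
    the whole space. Finiteness matters: the convention 0 for infinite
    dimensions would make the equality of dimensions void. *)
Lemma eq_quotient_dim_sub V V' n : subspace V' -> V' `<=` V ->
    codim_le V [set 0] n ->
    quotient_dim iota V [set 0] = quotient_dim iota V' [set 0] ->
  V `<=` V'.
Proof.
move=> sV' VV' Vn dimE z Vz.
have [b [Vb bfree bspan]] := quotient_dim_basis Vn.
have [b' [Vb' bfree' _]] := quotient_dim_basis (codim_leS VV' Vn).
rewrite -dimE in b' Vb' bfree'.
set d := quotient_dim iota V _ in b Vb bfree bspan b' Vb' bfree' *.
have Vd : codim_le V [set 0] d by exists 'I_d, b; rewrite card_ord.
have [||c [[i ci] c0]] := @codim_le_dependent V d _ (extend b' z) Vd.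
- by rewrite card_ord.
- by move=> i; apply: extend_in => // j; apply/VV'/Vb'.
have [cn0|cn0] := eqVneq (c ord_max) 0.
  move: c0; rewrite extend_sum cn0 rmorph0 mul0r addr0 => /bfree' cl.
  case: (unliftP ord_max i) ci => [j ->|->]; last by rewrite cn0 eqxx.
  by rewrite cl eqxx.
have -> : z = \sum_j iota (- (c ord_max)^-1 * c (lift ord_max j)) * b' j.
  by apply: subr0_eq; rewrite extend_solve // -extend_sum c0 mulr0.
exact: subspace_sum.
Qed.

End LinearAlgebra.

(** * Linear relations over K[z] *)

Section FunctionField.

Context (K F : fieldType) (iota : {rmorphism K -> F}).

Definition ev (z : F) (p : {poly K}) : F := (map_poly iota p).[z].

Lemma ev0 z : ev z 0 = 0. Proof. by rewrite /ev rmorph0 horner0. Qed.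
Lemma ev1 z : ev z 1 = 1. Proof. by rewrite /ev rmorph1 hornerC. Qed.
Lemma evX z : ev z 'X = z. Proof. by rewrite /ev map_polyX hornerX. Qed.
Lemma evC z a : ev z a%:P = iota a. Proof. by rewrite /ev map_polyC hornerC. Qed.
Lemma evD z p q : ev z (p + q) = ev z p + ev z q.
Proof. by rewrite /ev rmorphD hornerD. Qed.
Lemma evM z p q : ev z (p * q) = ev z p * ev z q.
Proof. by rewrite /ev rmorphM hornerM. Qed.
Lemma evB z p q : ev z (p - q) = ev z p - ev z q.
Proof. by rewrite /ev rmorphB hornerD hornerN. Qed.
Lemma ev_sum z (I : finType) (p : I -> {poly K}) :
  ev z (\sum_i p i) = \sum_i ev z (p i).
Proof. exact: (big_morph _ (evD z) (ev0 z)). Qed.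
Lemma ev_prod z (I : finType) (P : pred I) (p : I -> {poly K}) :
  ev z (\prod_(i | P i) p i) = \prod_(i | P i) ev z (p i).
Proof. exact: (big_morph _ (evM z) (ev1 z)). Qed.
Lemma ev_wide z n (p : {poly K}) : (size p <= n)%N ->
  ev z p = \sum_(i < n) iota p`_i * z ^+ i.
Proof.
move=> le_pn; rewrite /ev (@horner_coef_wide _ n) ?size_map_poly //.
by apply: eq_bigr => i _; rewrite coef_map.
Qed.

(** Says that F has rank less than N over K[z]. Relations over K[z] instead of
    K(z) avoid fractions, and for algebraic z the statement holds trivially
    when N > 0. *)
Definition dependence_bound (z : F) (N : nat) : Prop :=
  forall f : 'I_N -> F, exists a : 'I_N -> {poly K},
    (exists i, a i != 0) /\ \sum_i ev z (a i) * f i = 0.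

(** The product of the individual denominators is a common one, provided that
    the property [P i] is inherited by multiples. *)
Lemma common_denominator x (I : finType) (P : I -> {poly K} -> Prop) :
    (forall i q r, P i q -> P i (r * q)) ->
    (forall i, exists q, ev x q != 0 /\ P i q) ->
  exists q, ev x q != 0 /\ forall i, P i q.
Proof.
move=> Pmul /choice[q qP]; exists (\prod_i q i); split.
  by rewrite ev_prod; apply/prodf_neq0 => i _; case: (qP i).
by move=> i; rewrite (bigD1 i) //= mulrC; apply: Pmul; case: (qP i).
Qed.

Section Counting.

Context (x : F) (n : nat) (e : 'I_n -> F).

(** A filtration by degree of the K[x]-module spanned by the [e j]; its [d]-th
    step has dimension at most [n * d] over K. *)
Definition poly_combination d (g : F) : Prop :=
  exists p : 'I_n -> {poly K},
    (forall j, (size (p j) <= d)%N) /\ g = \sum_j ev x (p j) * e j.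

Lemma size_mul_bound (p q : {poly K}) d c :
  (size p <= d)%N -> (size q <= c)%N -> (size (p * q)%R <= d + c)%N.
Proof.
move=> sp sq; apply: leq_trans (size_polyMleq _ _) _.
by apply: leq_trans (leq_pred _) _; apply: leq_add.
Qed.

Lemma leq_max_family (I J : finType) (P : I -> J -> {poly K}) i j :
  (size (P i j) <= \max_i \max_j size (P i j))%N.
Proof.
apply: leq_trans (leq_bigmax i).
exact: (leq_bigmax (F := fun j => size (P i j))).
Qed.

Lemma poly_combinationM d c (q : {poly K}) g : (size q <= c)%N ->
  poly_combination d g -> poly_combination (d + c) (ev x q * g).
Proof.
move=> sq [p [sp ->]]; exists (fun j => p j * q); split=> [j|].
  exact: size_mul_bound.
by rewrite mulr_sumr; apply: eq_bigr => j _; rewrite evM mulrCA mulrA.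
Qed.

(** Multiplication by [z], after clearing denominators by [q], raises the
    degree by a constant [c]. This linear growth drives the counting
    argument. *)
Lemma poly_combination_endo d c z q (P : 'I_n -> 'I_n -> {poly K}) g :
    (forall i, ev x q * (z * e i) = \sum_j ev x (P i j) * e j) ->
    (forall i j, size (P i j) <= c)%N ->
  poly_combination d g -> poly_combination (d + c) (ev x q * (z * g)).
Proof.
move=> qz sP [p [sp ->]]; exists (fun j => \sum_i p i * P i j); split=> [j|].
  apply: (leq_trans (size_sum _ _ _)); apply/bigmax_leqP => i _.
  exact: size_mul_bound.
rewrite !mulr_sumr.
under [RHS]eq_bigr => j _ do rewrite ev_sum mulr_suml.
rewrite exchange_big /=; apply: eq_bigr => i _.
have -> : ev x q * (z * (ev x (p i) * e i)) =
          ev x (p i) * (ev x q * (z * e i)).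
  by rewrite !(mulrCA (ev x (p i))).
rewrite qz mulr_sumr; apply: eq_bigr => j _.
by rewrite evM mulrA.
Qed.

Lemma poly_combination_span d g : poly_combination d g ->
  exists c : 'I_n * 'I_d -> K,
    g = \sum_jl iota (c jl) * (x ^+ jl.2 * e jl.1).
Proof.
move=> [p [sp ->]]; exists (fun jl : 'I_n * 'I_d => (p jl.1)`_(nat_of_ord jl.2)).
rewrite -(pair_bigA _
  (fun (j : 'I_n) (l : 'I_d) => iota (p j)`_l * (x ^+ l * e j))) /=.
apply: eq_bigr => j _; rewrite (ev_wide _ (sp j)) mulr_suml.
by apply: eq_bigr => l _; rewrite mulrA.
Qed.

End Counting.

(** Let the [e j] span F over K(x). If multiplication by z raises degrees in x
    by c, then the N (M + 1) products of f_i by z^k, k <= M, lie in a space of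
    dimension n (M c + c') over K, where only c' depends on the f_i. For
    N > n c and M large there are more products than dimensions, and a linear
    relation between them is a relation over K[z] between the f_i. *)
Lemma dependence_bound_exists : function_field iota ->
  forall z, exists N, dependence_bound z N.
Proof.
move=> [x [xtr [n [e espan]]]] z.
have frac f : exists q, ev x q != 0 /\
    exists p : 'I_n -> {poly K}, ev x q * f = \sum_j ev x (p j) * e j.
  have [c [cfrac ->]] := espan f.
  have [|i|q [q0 qP]] := @common_denominator x 'I_n
      (fun j q => exists p, ev x q * c j = ev x p).
  - by move=> i q r [p pE]; exists (r * p); rewrite !evM -mulrA pE.
  - have [p [q [q0 ->]]] := cfrac i; exists q; split=> //; exists p.
    by rewrite mulrC divfK.
  exists q; split=> //; have [p pE] := choice qP.
  exists p; rewrite mulr_sumr.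
  by apply: eq_bigr => j _; rewrite mulrA pE.
have frac_family m (f : 'I_m -> F) : exists q, ev x q != 0 /\
    exists P : 'I_m -> 'I_n -> {poly K},
      forall i, ev x q * f i = \sum_j ev x (P i j) * e j.
  have [|i|q [q0 qP]] := @common_denominator x 'I_m
      (fun i q => exists p : 'I_n -> {poly K},
         ev x q * f i = \sum_j ev x (p j) * e j).
  - move=> i q r [p pE]; exists (fun j => r * p j).
    rewrite evM -mulrA pE mulr_sumr.
    by apply: eq_bigr => j _; rewrite evM mulrA.
  - exact: frac.
  by have [P PE] := choice qP; exists q; split=> //; exists P.
have [q [q0 [P qz]]] := frac_family _ (fun i => z * e i).
pose c := maxn (size q) (\max_i \max_j size (P i j)).
have sq : (size q <= c)%N by rewrite leq_maxl.
have sP i j : (size (P i j) <= c)%N.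
  rewrite leq_max; apply/orP; right.
  exact: leq_max_family.
(* The bound must not depend on f; M may. *)
exists (n * c).+1 => f.
have [r [r0 [Q rf]]] := frac_family _ f.
pose c' := \max_i \max_j size (Q i j).
have sQ i j : (size (Q i j) <= c')%N.
  exact: leq_max_family.
pose M := (n * c')%N.
have comb i k : poly_combination x e (c' + k * c)
    (ev x q ^+ k * (z ^+ k * (ev x r * f i))).
  elim: k => [|k IH].
    by rewrite !expr0 !mul1r; exists (Q i); rewrite addn0; split.
  rewrite mulSn (addnC c) addnA.
  have -> : ev x q ^+ k.+1 * (z ^+ k.+1 * (ev x r * f i)) =
      ev x q * (z * (ev x q ^+ k * (z ^+ k * (ev x r * f i)))).
    by rewrite !exprS -!mulrA (mulrCA _ z).
  exact: poly_combination_endo IH.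
have combD i k l : poly_combination x e (c' + (k + l) * c)
    (ev x q ^+ (k + l) * (z ^+ k * (ev x r * f i))).
  elim: l => [|l IH]; first by rewrite addn0; apply: comb.
  rewrite addnS mulSn (addnC c) addnA exprS -mulrA.
  exact: poly_combinationM.
have combM i (k : 'I_M.+1) : poly_combination x e (c' + M * c)
    (ev x q ^+ M * (z ^+ k * (ev x r * f i))).
  by have := combD i k (M - k)%N; rewrite subnKC // -ltnS.
have [|ik|a [[[i k] aik] a0]] := @card_lt_dependent K F iota
    ('I_(n * c).+1 * 'I_M.+1)%type ('I_n * 'I_(c' + M * c))%type
    (fun ik => ev x q ^+ M * (z ^+ ik.2 * (ev x r * f ik.1)))
    (fun jl => x ^+ jl.2 * e jl.1).
- rewrite !card_prod !card_ord mulSn addSn ltnS mulnDr leq_add2l (mulnC M) mulnA.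
  by rewrite leq_mul.
- exact/poly_combination_span/combM.
exists (fun i => \poly_(k < M.+1) a (i, inord k)); split.
  exists i; apply: contra_neq aik => /polyP/(_ k).
  by rewrite coef_poly ltn_ord inord_val coef0.
apply: (mulfI (mulf_neq0 (expf_neq0 M q0) r0)); rewrite mulr0 -[RHS]a0.
transitivity (\sum_i \sum_(k < M.+1) iota (a (i, k)) *
  (ev x q ^+ M * (z ^+ k * (ev x r * f i)))); last first.
  by rewrite pair_bigA; apply: eq_bigr => -[].
rewrite mulr_sumr; apply: eq_bigr => j _.
rewrite (ev_wide _ (size_poly _ _)) mulr_suml mulr_sumr.
apply: eq_bigr => l _; rewrite coef_poly ltn_ord inord_val.
rewrite -!mulrA !(mulrCA (iota _)); congr (_ * _).
exact: mulrCA.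
Qed.

End FunctionField.

(** * Valuation rings and their maximal ideals *)

Section PlaceAlgebra.

Context (K F : fieldType) (iota : {rmorphism K -> F}).
Implicit Types (P Q : place iota) (z t u w : F).

Lemma val_ring0 P : val_ring P 0.
Proof. by rewrite -(rmorph0 iota); apply: val_ring_const. Qed.

Lemma val_ring1 P : val_ring P 1.
Proof. by rewrite -(rmorph1 iota); apply: val_ring_const. Qed.

Lemma val_ringN P z : val_ring P z -> val_ring P (- z).
Proof. by move=> Oz; rewrite -sub0r; apply: val_ringB => //; apply: val_ring0. Qed.

Lemma val_ringD P y z : val_ring P y -> val_ring P z -> val_ring P (y + z).
Proof. by move=> Oy Oz; rewrite -(opprK z); apply/val_ringB/val_ringN. Qed.

Lemma val_ring_sum P (I : Type) (r : seq I) (p : pred I) (f : I -> F) :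
  (forall i, p i -> val_ring P (f i)) -> val_ring P (\sum_(i <- r | p i) f i).
Proof.
by move=> Of; apply: big_ind => //; [apply: val_ring0 | apply: val_ringD].
Qed.

Lemma val_ring_prod P (I : Type) (r : seq I) (p : pred I) (f : I -> F) :
  (forall i, p i -> val_ring P (f i)) -> val_ring P (\prod_(i <- r | p i) f i).
Proof.
by move=> Of; apply: big_ind => //; [apply: val_ring1 | apply: val_ringM].
Qed.

Lemma val_ringX P z n : val_ring P z -> val_ring P (z ^+ n).
Proof.
move=> Oz; elim: n => [|n IH]; first exact: val_ring1.
by rewrite exprS; apply: val_ringM.
Qed.

Lemma val_ring_ev P z p : val_ring P z -> val_ring P (ev iota z p).
Proof.
move=> Oz; rewrite (ev_wide _ _ (leqnn _)); apply: val_ring_sum => i _.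
by apply: val_ringM; [apply: val_ring_const | apply: val_ringX].
Qed.

Lemma max_ideal_ring P z : max_ideal P z -> val_ring P z.
Proof. by case. Qed.

Lemma val_units_ring P z : val_units P z -> val_ring P z.
Proof. by case. Qed.

Lemma val_units_neq0 P z : val_units P z -> z != 0.
Proof. by case. Qed.

Lemma unit_or_max P z : val_ring P z -> val_units P z \/ max_ideal P z.
Proof. by move=> Oz; case: (pselect (val_units P z)) => Uz; [left | right]. Qed.

Lemma max_ideal0 P : max_ideal P 0.
Proof. by split; [apply: val_ring0 | case; rewrite eqxx]. Qed.

Lemma max_idealN1 P : ~ max_ideal P 1.
Proof.
by case=> _; apply; split; rewrite ?oner_neq0 ?invr1 //; apply: val_ring1.
Qed.

Lemma not_ring_inv P z : ~ val_ring P z -> max_ideal P z^-1.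
Proof.
move=> nOz; split; first by case: (val_ring_total P z).
by case=> _ _; rewrite invrK.
Qed.

Lemma max_ideal_inv P z : z != 0 -> max_ideal P z -> ~ val_ring P z^-1.
Proof. by move=> z0 [Oz nU] OVz; apply: nU. Qed.

Lemma max_idealM P y z : val_ring P y -> max_ideal P z -> max_ideal P (y * z).
Proof.
move=> Oy [Oz nUz]; split=> [|[yz0 _ OV]]; first exact: val_ringM.
have [y0 z0] : y != 0 /\ z != 0 by apply/andP; rewrite -negb_or -mulf_eq0.
apply: nUz; split=> //.
by rewrite -(mulVKf y0 z^-1) -invfM; apply: val_ringM.
Qed.

(** One of y / z and z / y lies in the valuation ring, so one summand can be
    factored out. *)
Lemma max_idealD P y z :
  max_ideal P y -> max_ideal P z -> max_ideal P (y + z).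
Proof.
move=> My Mz.
have [->|y0] := eqVneq y 0; first by rewrite add0r.
have [->|z0] := eqVneq z 0; first by rewrite addr0.
have Oone := val_ring1 P.
case: (val_ring_total P (y / z)) => [Oyz|].
  have -> : y + z = (y / z + 1) * z by rewrite mulrDl divfK // mul1r.
  by apply: max_idealM => //; apply: val_ringD.
rewrite invf_div => Ozy.
have -> : y + z = (z / y + 1) * y by rewrite mulrDl divfK // mul1r addrC.
by apply: max_idealM => //; apply: val_ringD.
Qed.

Lemma max_ideal_sum P (I : Type) (r : seq I) (p : pred I) (f : I -> F) :
  (forall i, p i -> max_ideal P (f i)) -> max_ideal P (\sum_(i <- r | p i) f i).
Proof.
by move=> Mf; apply: big_ind => //; [apply: max_ideal0 | apply: max_idealD].
Qed.

Lemma max_idealX P z n : max_ideal P z -> max_ideal P (z ^+ n.+1).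
Proof.
move=> Mz; rewrite exprSr; apply: max_idealM => //.
exact/val_ringX/max_ideal_ring.
Qed.

Lemma val_units1 P : val_units P 1.
Proof. by split; rewrite ?oner_neq0 ?invr1 //; apply: val_ring1. Qed.

Lemma val_unitsV P z : val_units P z -> val_units P z^-1.
Proof. by case=> z0 Oz OVz; split; rewrite ?invr_eq0 ?invrK. Qed.

Lemma val_unitsM P y z : val_units P y -> val_units P z -> val_units P (y * z).
Proof.
case=> y0 Oy OVy [z0 Oz OVz]; split; first by rewrite mulf_neq0.
  exact: val_ringM.
by rewrite invfM; apply: val_ringM.
Qed.

Lemma val_unitsX P z n : val_units P z -> val_units P (z ^+ n).
Proof.
move=> Uz; elim: n => [|n IH]; first exact: val_units1.
by rewrite exprS; apply: val_unitsM.
Qed.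

Lemma val_unitsXz P z (n : int) : val_units P z -> val_units P (z ^ n).
Proof.
by move=> Uz; case: n => n; [|apply: val_unitsV]; apply: val_unitsX.
Qed.

Lemma val_units_const P (a : K) : a != 0 -> val_units P (iota a).
Proof.
move=> a0; split; first by rewrite fmorph_eq0.
  exact: val_ring_const.
by rewrite -fmorphV; apply: val_ring_const.
Qed.

Lemma val_units_max P z : val_units P z -> ~ max_ideal P z.
Proof. by move=> Uz [_]. Qed.

Lemma val_unitsD P u m : val_units P u -> max_ideal P m -> val_units P (u + m).
Proof.
move=> Uu Mm; case: (@unit_or_max P (u + m)) => //.
  by apply: val_ringD; [case: Uu | case: Mm].
move=> Mum; case: (val_units_max Uu).
rewrite -(addrK m u); apply: max_idealD => //; rewrite -mulN1r.
by apply: max_idealM => //; apply/val_ringN/val_ring1.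
Qed.

Lemma poly_split (p : {poly K}) : exists q, p = (p`_0)%:P + q * 'X.
Proof.
have : root (p - (p`_0)%:P) 0 by rewrite /root !hornerE horner_coef0 subrr.
case/factor_theorem => q; rewrite subr0 => /eqP pE; exists q.
by rewrite -(eqP pE) addrC subrK.
Qed.

(** The value at a zero of [z] is the constant coefficient. *)
Lemma ev_unit P z (p : {poly K}) :
  max_ideal P z -> p`_0 != 0 -> val_units P (ev iota z p).
Proof.
move=> Mz p0; have [q ->] := poly_split p.
rewrite evD evC evM evX; apply: val_unitsD; first exact: val_units_const.
by apply: max_idealM => //; apply/val_ring_ev/max_ideal_ring.
Qed.

Lemma ev_coef0 z (p : {poly K}) :
  p`_0 = 0 -> exists q, ev iota z p = ev iota z q * z.
Proof.
move=> p0; have [q pE] := poly_split p; exists q.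
by rewrite pE evD evC evM evX p0 rmorph0 add0r.
Qed.

(** Since z is invertible in F, common factors of the coefficients that are
    powers of the variable can be cancelled. *)
Lemma dependent_primitive (I : finType) z (f : I -> F) (a : I -> {poly K}) :
    z != 0 -> (exists i, a i != 0) -> \sum_i ev iota z (a i) * f i = 0 ->
  exists b : I -> {poly K},
    (exists i, (b i)`_0 != 0) /\ \sum_i ev iota z (b i) * f i = 0.
Proof.
move=> z0 [i]; have [n] := ubnP (size (a i)).
elim: n a => // n IH a le_n ai0 a0.
case: (pselect (exists j, (a j)`_0 != 0)) => [nz|all0]; first by exists a.
have /choice[b aE] : forall j, exists q, a j = q * 'X.
  move=> j; have [q aq] := poly_split (a j); exists q.
  rewrite {1}aq (_ : (a j)`_0 = 0) ?add0r //.
  by apply/eqP; apply: contra_notT all0 => ?; exists j.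
apply: (IH b).
- move: le_n; rewrite aE size_mulX //; apply: contra_neq ai0.
  by rewrite aE => ->; rewrite mul0r.
- by apply: contra_neq ai0; rewrite aE => ->; rewrite mul0r.
apply: (mulfI z0); rewrite mulr0 -[RHS]a0 mulr_sumr; apply: eq_bigr => j _.
by rewrite aE evM evX mulrA (mulrC z).
Qed.

End PlaceAlgebra.

(** * Places are discrete *)

Section Valuation.

Context (K F : fieldType) (iota : {rmorphism K -> F}).
Context (hF : function_field iota).
Implicit Types (P Q : place iota) (z t u w : F).

(** In a primitive relation over K[g 0] between the members g i of the chain,
    let j be the last index whose coefficient has nonzero constant term. The
    term of index j has strictly smaller valuation than all the others:
    earlier members have larger valuation, and later coefficients are
    divisible by g 0. *)
Lemma no_infinite_chain P (g : nat -> F) :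
    (forall i, g i != 0) -> (forall i, max_ideal P (g i)) ->
    (forall i, max_ideal P (g i / g i.+1)) -> False.
Proof.
move=> g0 Mg Mdiv.
have Mlt i j : (i < j)%N -> max_ideal P (g i / g j).
  elim: j => // j IH; rewrite ltnS leq_eqVlt => /orP[/eqP->|/IH Mij] //.
  have -> : g i / g j.+1 = (g i / g j) * (g j / g j.+1) by rewrite mulrA divfK.
  by apply: max_idealM => //; apply: max_ideal_ring.
have [N dep] := dependence_bound_exists hF (g 0%N).
have [a' [a'n0 a'0]] := dep (fun i => g i).
have [a [[i0 ai0] a0]] := dependent_primitive (g0 0%N) a'n0 a'0.
pose j := [arg max_(i > i0 | (a i)`_0 != 0) (i : nat)].
have [aj0 jmax] : (a j)`_0 != 0 /\ forall i, (a i)`_0 != 0 -> (i <= j)%N.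
  by rewrite /j; case: arg_maxnP.
have : \sum_i ev iota (g 0%N) (a i) * (g i / g j) = 0.
  under eq_bigr => i _ do rewrite mulrA.
  by rewrite -mulr_suml a0 mul0r.
rewrite (bigD1 j) //= divff // mulr1 => sum0.
suff Mrest : max_ideal P
    (\sum_(i < N | i != j) ev iota (g 0%N) (a i) * (g i / g j)).
  have := val_unitsD (ev_unit (Mg 0%N) aj0) Mrest.
  by rewrite sum0 => /val_units_neq0; rewrite eqxx.
apply: max_ideal_sum => i ij.
have Oev p : val_ring P (ev iota (g 0%N) p).
  exact/val_ring_ev/max_ideal_ring.
have [lt_ij|le_ji] := ltnP i j; first exact/max_idealM/Mlt.
have : (a i)`_0 = 0.
  apply/eqP; apply: contra_neqT ij => /jmax le_ij.
  by apply: val_inj; apply/eqP; rewrite eqn_leq le_ij.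
case/(ev_coef0 iota (g 0%N)) => q ->.
rewrite -mulrA; apply: max_idealM => //.
rewrite mulrCA mulrC; apply: max_idealM => //.
have [j0|j0] := posnP j; last exact/max_ideal_ring/Mlt.
by rewrite j0 divff //; apply: val_ring1.
Qed.

Lemma max_ideal_neq0 P : exists2 t, t != 0 & max_ideal P t.
Proof.
have [z nOz] := val_ring_neqF P; exists z^-1; last exact: not_ring_inv.
by rewrite invr_eq0; apply: contra_notN nOz => /eqP->; apply: val_ring0.
Qed.

(** If no element generated the maximal ideal, each nonzero element of it
    would be a proper multiple of another one, and iteration would give an
    infinite chain. *)
Lemma prime_element_exists P : exists2 t, t != 0 & prime_element P t.
Proof.
apply: contrapT => noprime.
have step t : exists t', t != 0 -> max_ideal P t ->
    [/\ t' != 0, max_ideal P t' & max_ideal P (t / t')].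
  case: (pselect (t != 0 /\ max_ideal P t)) => [[t0 Mt]|nt]; last first.
    by exists t => t0 Mt; case: nt.
  apply: contrapT => nostep; apply: noprime; exists t => //.
  apply/seteqP; split=> [w Mw|_ [y Oy <-]]; last first.
    by rewrite mulrC; apply: max_idealM.
  have [->|w0] := eqVneq w 0.
    by exists 0; rewrite ?mulr0 //; apply: val_ring0.
  exists (w / t); last by rewrite mulrC divfK.
  apply: contrapT => nO; apply: nostep; exists w => _ _; split=> //.
  by rewrite -invf_div; apply: not_ring_inv.
have [h hP] := choice step.
have [t t0 Mt] := max_ideal_neq0 P.
have good i : iter i h t != 0 /\ max_ideal P (iter i h t).
  by elim: i => // i [ti0 Mti]; have [] := hP _ ti0 Mti.
apply: (@no_infinite_chain P (fun i => iter i h t)) => i;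
  have [ti0 Mti] := good i => //.
by have [] := hP _ ti0 Mti.
Qed.

(** An element divisible by all powers of [t] would start the infinite chain
    of the quotients z / t^k. *)
Lemma val_archimedean P t z : z != 0 -> t != 0 -> max_ideal P t ->
  exists k, ~ val_ring P (z / t ^+ k).
Proof.
move=> z0 t0 Mt; apply: contrapT => allO.
have {}allO k : val_ring P (z / t ^+ k).
  by apply: contrapT => nO; apply: allO; exists k.
apply: (@no_infinite_chain P (fun i => z / t ^+ i.+1)) => i.
- by rewrite mulf_neq0 // invr_eq0 expf_neq0.
- rewrite (_ : z / t ^+ i.+1 = z / t ^+ i.+2 * t); first exact: max_idealM.
  by rewrite (exprSr t i.+1) invfM mulrA divfK.
- have -> : z / t ^+ i.+1 / (z / t ^+ i.+2) = t => //.
  rewrite (exprS t i.+1); field.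
  by rewrite z0 t0 expf_neq0.
Qed.

Lemma val_archimedean_mul P t z : t != 0 -> max_ideal P t ->
  exists k, val_ring P (z * t ^+ k).
Proof.
have [->|z0] := eqVneq z 0; first by exists 0%N; rewrite mul0r; apply: val_ring0.
move=> t0 Mt; have [|k nO] := @val_archimedean P t z^-1 _ t0 Mt.
  by rewrite invr_eq0.
by exists k; have /max_ideal_ring := not_ring_inv nO; rewrite invfM !invrK.
Qed.

Lemma unit_part P t z : t != 0 -> prime_element P t -> z != 0 ->
  exists n : int, val_units P (z / t ^ n).
Proof.
move=> t0 Pt z0.
have Mt : max_ideal P t.
  by rewrite Pt; exists 1; rewrite ?mulr1 //; apply: val_ring1.
have [k Ow] := val_archimedean_mul z t0 Mt; set w := z * _ in Ow.
have w0 : w != 0 by rewrite mulf_neq0 // expf_neq0.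
have [m0 nO0] := val_archimedean w0 t0 Mt.
have exm : exists m, `[< ~ val_ring P (w / t ^+ m) >] by exists m0; apply/asboolP.
case: (ex_minnP exm) => -[|m] /asboolP nOm minm.
  by case: nOm; rewrite expr0 divr1.
have Om : val_ring P (w / t ^+ m).
  apply: contrapT => /asboolP/minm; by rewrite ltnn.
exists (m%:Z - k%:Z).
have -> : z / t ^ (m%:Z - k%:Z) = w / t ^+ m.
  rewrite /w expfzDr // -invr_expz -!exprnP; field.
  by rewrite !expf_neq0.
case: (unit_or_max Om) => //; rewrite Pt => -[y Oy tyE].
case: nOm; rewrite exprSr invfM mulrA -tyE mulrC mulKf //.
Qed.

(** This characterizes the valuation by one fixed prime element [t]; all
    further properties of valuations follow from it. Two prime elements differ
    by a unit, so the choice made in the definition does not matter. *)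
Lemma valuation_spec P : exists t, [/\ t != 0, max_ideal P t &
  forall z (n : int), z != 0 -> val_units P (z / t ^ n) <-> valuation P z = n].
Proof.
have [t t0 Pt] := prime_element_exists P.
have Mt : max_ideal P t.
  by rewrite Pt; exists 1; rewrite ?mulr1 //; apply: val_ring1.
have Uexp (n : int) : val_units P (t ^ n) -> n = 0.
  case: n => [[|n]|n] //.
    by move/val_units_max; case; apply: max_idealX.
  move/val_unitsV => UV; have : val_units P (t ^+ n.+1) by rewrite -[t ^+ _]invrK.
  by move/val_units_max; case; apply: max_idealX.
have uniq z (n : int) : z != 0 -> val_units P (z / t ^ n) -> valuation P z = n.
  move=> z0 Uz.
  have : exists n : int, exists t u,
      [/\ prime_element P t, val_units P u & z = t ^ n * u].
    by exists n, t, (z / t ^ n); split=> //; rewrite mulrC divfK // expfz_neq0.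
  move=> /(xgetPex 0); rewrite -/(valuation P z); set m := valuation P z.
  move=> [t' [u [Pt' Uu zE]]].
  have Mt' : max_ideal P t'.
    by rewrite Pt'; exists 1; rewrite ?mulr1 //; apply: val_ring1.
  have t'0 : t' != 0.
    move: Mt; rewrite Pt' => -[y _ tE].
    by apply: contra_neq t0 => t'0; rewrite -tE t'0 mul0r.
  have Ut : val_units P (t' / t).
    split; first by rewrite mulf_neq0 // invr_eq0.
      by move: Mt'; rewrite Pt => -[y Oy <-]; rewrite mulrC mulKf.
    by rewrite invf_div; move: Mt; rewrite Pt' => -[y Oy <-]; rewrite mulrC mulKf.
  apply/eqP; rewrite -subr_eq0; apply/eqP/Uexp.
  have -> : t ^ (m - n) = z / t ^ n * (u^-1 * ((t' / t) ^ m)^-1).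
    rewrite expfzDr // -invr_expz zE expfzMl exprz_inv -invr_expz; field.
    by rewrite !expfz_neq0 // (val_units_neq0 Uu).
  apply: val_unitsM => //; apply: val_unitsM; apply: val_unitsV => //.
  exact: val_unitsXz.
exists t; split=> // z n z0; split=> [|zn]; first exact: uniq.
have [m Um] := unit_part t0 Pt z0.
by rewrite -zn (uniq _ _ z0 Um).
Qed.

End Valuation.

(** * Existence of places: Zorn's lemma *)

Section PlaceExtension.

Context (K F : fieldType) (iota : {rmorphism K -> F}).
Implicit Types (A B : set F) (z w : F) (p q : {poly F}).

Definition const_subring A : Prop :=
  [/\ forall a, A (iota a), forall y z, A y -> A z -> A (y - z)
    & forall y z, A y -> A z -> A (y * z)].

Definition adjoin A w : set F :=
  [set p.[w] | p in [set p : {poly F} | forall i, A p`_i]].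

Section Closure.

Context (A : set F).
Context (sA : const_subring A).

Lemma const_subring1 : A 1.
Proof. by case: sA => AK _ _; rewrite -(rmorph1 iota). Qed.

Lemma const_subring0 : A 0.
Proof. by case: sA => AK _ _; rewrite -(rmorph0 iota). Qed.

Lemma const_subringB y z : A y -> A z -> A (y - z).
Proof. by case: sA => _ AB _; apply: AB. Qed.

Lemma const_subringD y z : A y -> A z -> A (y + z).
Proof.
move=> Ay Az; rewrite -(opprK z); apply: const_subringB => //.
by rewrite -sub0r; apply: const_subringB => //; apply: const_subring0.
Qed.

Lemma const_subringM y z : A y -> A z -> A (y * z).
Proof. by case: sA => _ _; apply. Qed.

Lemma const_subring_sum (I : finType) (f : I -> F) :
  (forall i, A (f i)) -> A (\sum_i f i).
Proof.
by move=> Af; apply: big_ind => //; [apply: const_subring0 | apply: const_subringD].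
Qed.

Lemma const_subringX z n : A z -> A (z ^+ n).
Proof.
move=> Az; elim: n => [|n IH]; first exact: const_subring1.
by rewrite exprS; apply: const_subringM.
Qed.

Lemma adjoin_const_subring w : const_subring (adjoin A w).
Proof.
split=> [a|_ _ [p Ap <-] [q Aq <-]|_ _ [p Ap <-] [q Aq <-]].
- exists (iota a)%:P; rewrite ?hornerC // => i.
  rewrite coefC; case: ifP => _; last exact: const_subring0.
  by case: sA.
- by exists (p - q); rewrite ?hornerE // => i; rewrite coefB; apply: const_subringB.
- exists (p * q); rewrite ?hornerE // => i.
  by rewrite coefM; apply: const_subring_sum => j; apply: const_subringM.
Qed.

Lemma adjoin_sub w : A `<=` adjoin A w.
Proof.
move=> a Aa; exists a%:P; rewrite ?hornerC // => i.
by rewrite coefC; case: ifP => _ //; apply: const_subring0.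
Qed.

Lemma adjoin_gen w : adjoin A w w.
Proof.
exists 'X; rewrite ?hornerX // => i; rewrite coefX.
by case: (i == _); [apply: const_subring1 | apply: const_subring0].
Qed.

End Closure.

Section MaximalRing.

Context (z : F) (A : set F).
Context (sA : const_subring A) (AVz : A z^-1) (nAz : ~ A z).
Context (maxA : forall w, ~ A w -> adjoin A w z).

Let z0 : z != 0.
Proof. by apply: contra_notN nAz => /eqP->; apply: const_subring0. Qed.

(** If s = 1 - b / z were not invertible in A, then z would be a polynomial in
    s^-1 over A. Multiplication by a power of s, which is congruent to 1
    modulo z^-1 A, would put z into A. *)
Lemma one_sub_inv b : A b -> A (1 - z^-1 * b)^-1.
Proof.
move=> Ab; set s := 1 - _.
have As : A s.
  apply: const_subringB => //; first exact: const_subring1.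
  exact: const_subringM.
have s0 : s != 0.
  apply: contra_notN nAz => /eqP/subr0_eq sE.
  by rewrite (_ : z = b) // -[RHS](mulVKf z0) -sE mulr1.
apply: contrapT => /maxA [p Ap pz].
have [k le_k] : exists k, (size p <= k.+1)%N by exists (size p).
have Azs : A (z * s ^+ k).
  rewrite -pz (horner_coef_wide _ le_k) mulr_suml; apply: const_subring_sum => // i.
  have le_ik : (i <= k)%N by rewrite -ltnS.
  have -> : s ^+ k = s ^+ i * s ^+ (k - i) by rewrite -exprD subnKC.
  rewrite -mulrA exprVn mulKf ?expf_neq0 //.
  by apply: const_subringM => //; apply: const_subringX.
have [c Ac sE] : exists2 c, A c & s ^+ k = 1 - z^-1 * c.
  elim: (k) => [|l [c Ac sE]].
    by exists 0; rewrite ?mulr0 ?subr0 //; apply: const_subring0.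
  exists (c + b - z^-1 * c * b).
    apply: const_subringB => //; first exact: const_subringD.
    by do 2?apply: const_subringM.
  by rewrite exprS sE /s; ring.
apply: nAz; have -> : z = z * s ^+ k + c by rewrite sE; field.
exact: const_subringD.
Qed.

(** The relation in w^-1 expresses w^n, where n is the degree of p, by lower
    powers of w with coefficients in A; substitution in p(w) lowers the
    degree. *)
Lemma shorten_relation w p q : w != 0 -> (forall i, A p`_i) ->
    (forall i, A q`_i) -> p.[w] = z -> q.[w^-1] = z -> (size q <= size p)%N ->
  exists r : {poly F}, [/\ forall i, A r`_i, r.[w] = z & (size r < size p)%N].
Proof.
move=> w0 Ap Aq pz qz le_qp.
have [n pn] : exists n, size p = n.+1.
  case: (size p) (size_poly_eq0 p) => [|n] => [/esym/eqP p0|_]; last by exists n.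
  by move: pz z0; rewrite p0 horner0 => <-; rewrite eqxx.
set s := 1 - z^-1 * q`_0; have AVs : A s^-1 by apply: one_sub_inv.
have s0 : s != 0.
  apply: contra_notN nAz => /eqP/subr0_eq sE.
  by rewrite (_ : z = q`_0) // -[RHS](mulVKf z0) -sE mulr1.
pose c := p`_n * (z^-1 * s^-1).
have Ac : A c by do 2?apply: const_subringM.
(* The term of degree n in p is replaced by c * (q(w^-1) - q_0) * w^n. *)
exists (\poly_(i < n) (p`_i + c * q`_(n - i))); split.
- move=> i; rewrite coef_poly; case: ifP => _; last exact: const_subring0.
  by apply: const_subringD => //; apply: const_subringM.
- rewrite horner_poly.
  under eq_bigr => i _ do rewrite mulrDl -mulrA.
  rewrite big_split /= -mulr_sumr.
  rewrite -[RHS]pz (@horner_coef_wide _ n.+1) ?pn //.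
  rewrite big_ord_recr /=; congr (_ + _).
  have wnE : w ^+ n * (z * s) = \sum_(i < n) q`_(n - i) * w ^+ i.
    have -> : z * s = \sum_(j < n) q`_j.+1 * w^-1 ^+ j.+1.
      rewrite /s mulrBr mulr1 mulVKf // -{1}qz.
      rewrite (@horner_coef_wide _ n.+1) ?big_ord_recl -?pn //.
      by rewrite expr0 mulr1 addrC addKr.
    rewrite [RHS](reindex_inj rev_ord_inj) /= mulr_sumr; apply: eq_bigr => j _.
    rewrite subKn //= mulrCA; congr (_ * _).
    have -> : w ^+ n = w ^+ (n - j.+1) * w ^+ j.+1 by rewrite -exprD subnK.
    by rewrite exprVn mulfK ?expf_neq0.
  by rewrite -wnE /c; field; rewrite z0 s0.
- by rewrite pn ltnS size_poly.
Qed.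

(** Otherwise z would be a polynomial in w and also in w^-1, over A. The one
    of larger degree can be shortened with the help of the other, without
    end. *)
Lemma maximal_ring_total w : A w \/ A w^-1.
Proof.
apply: contrapT => /not_orP[nAw nAVw].
have w0 : w != 0.
  by apply: contra_notN nAw => /eqP->; apply: const_subring0.
have [p Ap pz] := maxA nAw; have [q Aq qz] := maxA nAVw.
have [n] := ubnP (size p + size q)%N.
elim: n => // n IH in w w0 {nAw nAVw} p Ap pz q Aq qz *; rewrite ltnS => le_n.
case: (leqP (size q) (size p)) => [le_qp|/ltnW le_pq].
  have [r [Ar rz lt_r]] := shorten_relation w0 Ap Aq pz qz le_qp.
  apply: (IH w w0 r Ar rz q Aq qz).
  by apply: leq_trans le_n; rewrite ltn_add2r.
have [||r [Ar rz lt_r]] := @shorten_relation w^-1 q p _ Aq Ap qz _ le_pq.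
- by rewrite invr_eq0.
- by rewrite invrK.
apply: (IH w w0 p Ap pz r Ar rz).
by apply: leq_trans le_n; rewrite ltn_add2l.
Qed.

End MaximalRing.

(** Chevalley's extension argument: a ring that is maximal among those that
    contain K and z^-1 but not z is a valuation ring. The ring K[z^-1] is a
    starting point, because z is transcendental. *)
Lemma exists_place_pole z : full_constant_field iota ->
  (forall a, z <> iota a) -> exists P : place iota, ~ val_ring P z.
Proof.
move=> hK znK.
have z0 : z != 0.
  by apply/eqP => z0; apply: (znK 0); rewrite rmorph0.
pose good A := [/\ const_subring A, A z^-1 & ~ A z].
have goodKy : good [set ev iota z^-1 p | p in [set: {poly K}]].
  split.
  - split=> [a|_ _ [p _ <-] [q _ <-]|_ _ [p _ <-] [q _ <-]].
    + by exists a%:P; rewrite ?evC.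
    + by exists (p - q); rewrite // evB.
    + by exists (p * q); rewrite ?evM.
  - by exists 'X; rewrite ?evX.
  - move=> [p _ pz]; have [|a za] := hK z^-1.
      exists ('X * p - 1).
        apply/eqP => /polyP/(_ 0%N).
        by rewrite coefB coefXM coefC /= sub0r => /eqP; rewrite coef0 oppr_eq0 oner_eq0.
      rewrite /root -/(ev iota _ _) evB evM evX ev1 pz.
      by rewrite mulVf // subrr.
    by apply: (znK a^-1); rewrite fmorphV -za invrK.
(* The empty set is admitted because it is the union of the empty chain. *)
have [|A [[A0|[sA AVz nAz]] maxA]] :=
  @Zorn_bigcup _ (fun A => A = set0 \/ good A).
- move=> G Ggood Gtot.
  case: (pselect (exists2 B, G B & B !=set0)) => [[B GB [b Bb]]|noB].
    right; have goodX X x : G X -> X x -> good X.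
      by move=> GX Xx; have [X0|//] := Ggood X GX; rewrite X0 in Xx.
    have join x y : (\bigcup_(X in G) X) x -> (\bigcup_(X in G) X) y ->
        exists2 X, G X & [/\ good X, X x & X y].
      move=> [X GX Xx] [Y GY Yy]; have [XY|YX] := Gtot X Y GX GY.
        by exists Y => //; split=> //; [apply: goodX Yy | apply: XY].
      by exists X => //; split=> //; [apply: goodX Xx | apply: YX].
    have [[BK _ _] BVz _] := goodX B b GB Bb.
    split.
    - split=> [a|x y Ux Uy|x y Ux Uy]; first by exists B.
        by have [X GX [[[_ XB _] _ _] Xx Xy]] := join x y Ux Uy;
           exists X => //; apply: XB.
      by have [X GX [[[_ _ XM] _ _] Xx Xy]] := join x y Ux Uy;
         exists X => //; apply: XM.
    - by exists B.
    - by move=> [X GX Xz]; have [_ _] := goodX X z GX Xz.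
  left; apply/seteqP; split=> // x [B GB Bx].
  by apply: noB; exists B => //; exists x.
- case: (maxA [set ev iota z^-1 p | p in [set: {poly K}]]); last by right.
  rewrite A0; split=> // sub0; have [_] := goodKy.
  by case/sub0.
have Amax w : ~ A w -> adjoin A w z.
  move=> nAw; apply: contrapT => nz; apply: (maxA (adjoin A w)).
    split; first exact: adjoin_sub.
    by move=> /(_ w) sub; apply/nAw/sub; apply: adjoin_gen.
  right; split=> //; first exact: adjoin_const_subring.
  exact: adjoin_sub.
have total := maximal_ring_total sA AVz nAz Amax.
have [AK AB AM] := sA.
have neqK : exists2 y, A y & forall a, y <> iota a.
  exists z^-1 => // a za; apply: (znK a^-1).
  by rewrite fmorphV -za invrK.
by exists (Place AK AB AM neqK (ex_intro _ z nAz) total).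
Qed.

End PlaceExtension.

(** * Arithmetic of valuations *)

Section ValuationArithmetic.

Context (K F : fieldType) (iota : {rmorphism K -> F}).
Context (hF : function_field iota).
Implicit Types (P Q : place iota) (z t u w : F).

Lemma valuationM P y z : y != 0 -> z != 0 ->
  valuation P (y * z) = valuation P y + valuation P z.
Proof.
move=> y0 z0; have [t [t0 _ spec]] := valuation_spec hF P.
apply/spec; first by rewrite mulf_neq0.
have -> : y * z / t ^ (valuation P y + valuation P z) =
    y / t ^ valuation P y * (z / t ^ valuation P z).
  by rewrite expfzDr // invfM mulrACA.
by apply: val_unitsM; apply/spec.
Qed.

Lemma val_units_valuation P z : z != 0 -> val_units P z <-> valuation P z = 0.
Proof.
move=> z0; have [t [t0 _ spec]] := valuation_spec hF P.
by rewrite -spec // expr0z divr1.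
Qed.

Lemma valuation1 P : valuation P 1 = 0.
Proof. by apply/val_units_valuation; [apply: oner_neq0 | apply: val_units1]. Qed.

Lemma valuationV P z : z != 0 -> valuation P z^-1 = - valuation P z.
Proof.
move=> z0; have Vz0 : z^-1 != 0 by rewrite invr_eq0.
have := valuationM P Vz0 z0; rewrite (mulVf z0) valuation1.
by move/esym/eqP; rewrite addr_eq0 => /eqP.
Qed.

Lemma valuationX P z n : z != 0 -> valuation P (z ^+ n) = valuation P z *+ n.
Proof.
move=> z0; elim: n => [|n IH]; first by rewrite expr0 mulr0n valuation1.
by rewrite exprS mulrS valuationM ?expf_neq0 // IH.
Qed.

Lemma max_ideal_valuation P z : z != 0 -> max_ideal P z <-> 0 < valuation P z.
Proof.
move=> z0; have [t [t0 Mt spec]] := valuation_spec hF P.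
have /spec := erefl (valuation P z) => /(_ z0); set n := valuation P z => Un.
have zE : z = z / t ^ n * t ^ n by rewrite divfK // expfz_neq0.
case: n Un zE => [[|n]|n] Un zE.
- by rewrite ltxx; split=> //; move: Un; rewrite expr0z divr1 => /val_units_max.
- split=> // _; rewrite zE; apply: max_idealM; first exact: val_units_ring.
  exact: max_idealX.
- split=> // Mz; have := max_idealM (val_ringX n.+1 (max_ideal_ring Mt)) Mz.
  have -> : t ^+ n.+1 * z = z / t ^ (Negz n) by rewrite mulrC invrK.
  by move/(val_units_max Un).
Qed.

Lemma val_ring_valuation P z : z != 0 -> val_ring P z <-> 0 <= valuation P z.
Proof.
move=> z0; rewrite le_eqVlt; split.
  move=> /unit_or_max[/(val_units_valuation P z0)->|]; first by rewrite eqxx.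
  by move/(max_ideal_valuation P z0) => ->; rewrite orbT.
case/orP => [/eqP/esym/(val_units_valuation P z0)/val_units_ring//|].
by move/(max_ideal_valuation P z0)/max_ideal_ring.
Qed.

Lemma valuation_le P y z : y != 0 -> z != 0 ->
  val_ring P (z / y) <-> valuation P y <= valuation P z.
Proof.
move=> y0 z0; rewrite val_ring_valuation ?mulf_neq0 ?invr_eq0 //.
by rewrite valuationM ?invr_eq0 // valuationV // subr_ge0.
Qed.

Lemma valuation_lt P y z : y != 0 -> z != 0 ->
  max_ideal P (z / y) <-> valuation P y < valuation P z.
Proof.
move=> y0 z0; rewrite max_ideal_valuation ?mulf_neq0 ?invr_eq0 //.
by rewrite valuationM ?invr_eq0 // valuationV // subr_gt0.
Qed.

Lemma valuation_const P (a : K) : a != 0 -> valuation P (iota a) = 0.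
Proof.
move=> a0; apply/val_units_valuation; rewrite ?fmorph_eq0 //.
exact: val_units_const.
Qed.

(** The fractional ideal of elements of valuation at least [n], with 0
    included although the valuation of 0 is not meaningful. *)
Definition order_ge P (n : int) : set F := [set z | z != 0 -> n <= valuation P z].

Lemma order_geE P n : exists2 t, t != 0 & valuation P t = n /\
  forall z, order_ge P n z <-> val_ring P (z / t).
Proof.
have [t [t0 Mt spec]] := valuation_spec hF P.
have tn0 : t ^ n != 0 by rewrite expfz_neq0.
have vtn : valuation P (t ^ n) = n.
  by apply/spec => //; rewrite divff //; apply: val_units1.
exists (t ^ n) => //; split=> // z; have [->|z0] := eqVneq z 0.
  rewrite mul0r; split=> [_|_]; first exact: val_ring0.
  by rewrite /order_ge /= eqxx.
by rewrite valuation_le // vtn /order_ge /=; split=> //; apply.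
Qed.

Lemma order_ge_subspace P n : subspace iota (order_ge P n).
Proof.
have [t t0 [_ tE]] := order_geE P n; split.
  by rewrite /order_ge /= eqxx.
move=> a u v /tE Ou /tE Ov; apply/tE; rewrite mulrDl -mulrA.
by apply: val_ringD => //; apply: val_ringM => //; apply: val_ring_const.
Qed.

(** The strict triangle inequality; the second summand may vanish. *)
Lemma valuation_addl P y z :
    y != 0 -> (z != 0 -> valuation P y < valuation P z) ->
  y + z != 0 /\ valuation P (y + z) = valuation P y.
Proof.
move=> y0; have [->|z0] := eqVneq z 0; first by rewrite addr0.
move=> /(_ isT)/(valuation_lt P y0 z0) Mzy.
have := val_unitsD (val_units1 P) Mzy.
have -> : 1 + z / y = (y + z) / y by rewrite mulrDl divff.
move=> U; have yz0 : y + z != 0.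
  by apply: contraTneq (val_units_neq0 U) => ->; rewrite mul0r eqxx.
split=> //; apply/eqP; rewrite -subr_eq0 -valuationV // -valuationM ?invr_eq0 //.
by apply/eqP/val_units_valuation => //; rewrite mulf_neq0 ?invr_eq0.
Qed.

(** The residue field has a one-element basis over K. Since 1 is not in the
    maximal ideal, this basis can be replaced by 1. *)
Lemma rational_residue P z : rational P -> val_ring P z ->
  exists c, max_ideal P (z - iota c).
Proof.
move=> ratP Oz.
have [b [Ob _ span]] : exists b : 'I_1 -> F,
    quotient_basis iota (val_ring P) (max_ideal P) b.
  move: ratP; rewrite /rational /place_degree /quotient_dim.
  by case: xgetP => // m -> [b bP] m1; rewrite m1 in b bP; exists b.
have [c0] := span _ (val_ring1 P); rewrite big_ord1 => M1.
have [c] := span _ Oz; rewrite big_ord1 => Mz.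
have cn0 : c0 ord0 != 0.
  apply: contra_notN (@max_idealN1 _ _ _ P) => /eqP c00.
  by move: M1; rewrite c00 rmorph0 mul0r subr0.
exists (c ord0 / c0 ord0).
have -> : z - iota (c ord0 / c0 ord0) = (z - iota (c ord0) * b ord0) +
    iota (- (c ord0 / c0 ord0)) * (1 - iota (c0 ord0) * b ord0).
  rewrite rmorphN !fmorph_div; field; rewrite ?fmorph_eq0 //.
apply: max_idealD => //; apply: max_idealM => //; exact: val_ring_const.
Qed.

(** At a rational place the quotient y / z, a unit, has a constant as
    residue. *)
Lemma rational_cancel P y z : rational P -> y != 0 -> z != 0 ->
    valuation P y = valuation P z ->
  exists c, y - iota c * z != 0 -> valuation P y < valuation P (y - iota c * z).
Proof.
move=> ratP y0 z0 vyz; have [|c Mc] := @rational_residue P (y / z) ratP.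
  by apply/valuation_le => //; rewrite vyz.
exists c => n0; rewrite vyz; apply/valuation_lt => //.
by rewrite mulrBl mulfK.
Qed.

End ValuationArithmetic.

(** * Regular functions near a zero *)

Section Approximation.

Context (K F : fieldType) (iota : {rmorphism K -> F}).
Context (hF : function_field iota).
Implicit Types (P Q R : place iota) (y z t u w : F).

(** Take a primitive relation sum_i a_i(y) w^i = 0 and put
    B_j = sum_(i >= j) a_i(y) w^(i - j). Where y is regular, B_j and B_j w are
    regular: this is clear if w is regular, and otherwise the relation
    rewrites them as polynomials in w^-1. Not all B_j vanish at P, because
    a_j(y) = B_j - w B_(j+1) and some a_j has nonzero constant term. *)
Lemma local_denominator P y w : y != 0 -> max_ideal P y -> val_ring P w ->
  exists2 b, val_units P b &
    forall Q, val_ring Q y -> val_ring Q b /\ val_ring Q (b * w).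
Proof.
move=> y0 My Ow; have [N dep] := dependence_bound_exists hF y.
have [a' [a'n0 a'0]] := dep (fun i => w ^+ i).
have [a [[i0 ai0] a0]] := dependent_primitive y0 a'n0 a'0.
pose al i := ev iota y (a i).
pose B j := \sum_(i < N | (j <= i)%N) al i * w ^+ (i - j).
have BS (j : 'I_N) : al j = B j - w * B j.+1.
  rewrite /B (bigD1 j) //= subnn expr0 mulr1 mulr_sumr -addrA.
  rewrite (eq_bigl (fun i : 'I_N => (j < i)%N)); last first.
    by move=> i; rewrite ltn_neqAle eq_sym andbC.
  rewrite -sumrB big1 ?addr0 // => i lt_ji.
  by rewrite mulrCA -exprS subnSK // subrr.
have [j UB] : exists j, val_units P (B j).
  apply: contrapT => noU.
  have MB j : max_ideal P (B j).
    have OB : val_ring P (B j).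
      apply: val_ring_sum => i _; apply: val_ringM; last exact: val_ringX.
      exact/val_ring_ev/max_ideal_ring.
    by case: (unit_or_max OB) => // U; case: noU; exists j.
  have := val_units_max (ev_unit My ai0); apply.
  rewrite -/(al _) BS; apply: max_idealD => //.
  by rewrite -mulNr; apply: max_idealM => //; apply: val_ringN.
exists (B j) => // Q Oy.
have Oal i : val_ring Q (al i) by apply: val_ring_ev.
case: (pselect (val_ring Q w)) => [Oww|nOw].
  have OB : val_ring Q (B j).
    by apply: val_ring_sum => i _; apply: val_ringM => //; apply: val_ringX.
  by split=> //; apply: val_ringM.
have OVw := max_ideal_ring (not_ring_inv nOw).
have w0 : w != 0 by apply: contra_notN nOw => /eqP->; apply: val_ring0.
have BE : B j = - \sum_(i < N | (i < j)%N) al i * w^-1 ^+ (j - i).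
  apply: (mulIf (expf_neq0 j w0)); apply/eqP; rewrite mulNr -addr_eq0.
  apply/eqP; rewrite -[RHS]a0 [RHS](bigID (fun i : 'I_N => (j <= i)%N)) /=.
  rewrite !mulr_suml; congr (_ + _).
    by apply: eq_bigr => i le_ji; rewrite -mulrA -exprD subnK.
  apply: eq_big => [i|i lt_ij]; first by rewrite ltnNge.
  rewrite -mulrA; congr (_ * _).
  have -> : w ^+ j = w ^+ (j - i) * w ^+ i by rewrite -exprD subnK // ltnW.
  by rewrite exprVn mulKf ?expf_neq0.
rewrite BE; split.
  by apply/val_ringN/val_ring_sum => i _; apply: val_ringM => //; apply: val_ringX.
rewrite mulNr mulr_suml; apply/val_ringN/val_ring_sum => i lt_ij.
rewrite -mulrA -(subnSK lt_ij) exprSr divfK //.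
by apply: val_ringM => //; apply: val_ringX.
Qed.

Lemma place_ext P Q : val_ring P = val_ring Q -> P = Q.
Proof.
case: P Q => [A a1 a2 a3 a4 a5 a6] [B b1 b2 b3 b4 b5 b6] /= AB.
by subst B; congr Place; apply: Prop_irrelevance.
Qed.

(** A discrete valuation ring is a maximal proper subring: for z outside of
    it, every element is a product of an element of the ring and a power of
    z. *)
Lemma val_ring_incomparable P Q :
  P <> Q -> exists2 z, val_ring P z & ~ val_ring Q z.
Proof.
move=> PQ; apply: contrapT => noz.
have sub z : val_ring P z -> val_ring Q z.
  by move=> Oz; apply: contrapT => nO; apply: noz; exists z.
apply: PQ; apply: place_ext; apply/seteqP; split=> // z OQz.
apply: contrapT => nOPz; have [f nOf] := val_ring_neqF Q; apply: nOf.
have z0 : z != 0 by apply: contra_notN nOPz => /eqP->; apply: val_ring0.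
have [|k Ok] := val_archimedean_mul hF f _ (not_ring_inv nOPz).
  by rewrite invr_eq0.
have -> : f = f * z^-1 ^+ k * z ^+ k by rewrite exprVn divfK // expf_neq0.
by apply: val_ringM; [apply: sub | apply: val_ringX].
Qed.

(** Incomparable valuation rings give an element a / b with a zero at P and a
    pole at Q. *)
Lemma place_separation P Q : P <> Q -> exists2 w, val_units P w & max_ideal Q w.
Proof.
move=> PQ; have [a OPa nOQa] := val_ring_incomparable PQ.
have [b OQb nOPb] := val_ring_incomparable (nesym PQ).
have a0 : a != 0 by apply: contra_notN nOQa => /eqP->; apply: val_ring0.
have b0 : b != 0 by apply: contra_notN nOPb => /eqP->; apply: val_ring0.
have MP : max_ideal P (a / b) by apply: max_idealM => //; apply: not_ring_inv.
have MQ : max_ideal Q (b / a) by apply: max_idealM => //; apply: not_ring_inv.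
have UP := val_unitsD (val_units1 P) MP.
have UQ := val_unitsD (val_units1 Q) MQ.
exists (1 + a / b)^-1; first exact: val_unitsV.
have -> : (1 + a / b)^-1 = (1 + b / a)^-1 * (b / a).
  field; rewrite a0 b0 /=; have := val_units_neq0 UQ.
  have -> : 1 + b / a = (a + b) / a by field.
  by rewrite mulf_eq0 negb_or => /andP[-> _].
by apply: max_idealM => //; have [] := val_unitsV UQ.
Qed.

Lemma regular_separation P Q y : y != 0 -> max_ideal P y -> val_ring Q y ->
  P <> Q -> exists u, [/\ val_units P u, max_ideal Q u &
    forall R : place iota, val_ring R y -> val_ring R u].
Proof.
move=> y0 My OQy PQ; have [w Uw Mw] := place_separation PQ.
have [b Ub breg] := local_denominator y0 My (val_units_ring Uw).
exists (b * w); split; first exact: val_unitsM.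
  by apply: max_idealM => //; case: (breg Q OQy).
by move=> R /breg[].
Qed.

(** For distinct zeros Q_i of y, products of separating functions give h_i
    that is a unit at Q_i and vanishes at the others. In a primitive relation
    over K[y] evaluation at Q_i shows that the i-th coefficient has no
    constant term; so the h_i are independent and their number is bounded. *)
Lemma finite_zeros y : y != 0 ->
  cardinality.finite_set [set Q : place iota | max_ideal Q y].
Proof.
move=> y0; apply: contrapT => infZ.
have [N dep] := dependence_bound_exists hF y.
have [B BZ leNB] := cardinality.infinite_set_fset N infZ.
have [P0 _] := cardinality.infinite_setN0 infZ.
pose f (i : 'I_N) := nth P0 (finmap.enum_fset B) i.
have Mf i : max_ideal (f i) y.
  by apply: BZ; apply: mem_nth; apply: leq_trans leNB.
have finj i j : i <> j -> f i <> f j.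
  move=> ij /eqP; rewrite nth_uniq ?(leq_trans _ leNB) ?finmap.fset_uniq //.
  by move/eqP/val_inj.
have /choice[u uP] : forall ij : 'I_N * 'I_N, exists u, ij.1 <> ij.2 ->
    [/\ val_units (f ij.1) u, max_ideal (f ij.2) u
      & forall R : place iota, val_ring R y -> val_ring R u].
  move=> [i j] /=; case: (pselect (i = j)) => [->|ij]; first by exists 0.
  have [|u uP] := regular_separation y0 (Mf i) (max_ideal_ring (Mf j)).
    exact: finj.
  by exists u.
pose h (i : 'I_N) := \prod_(j < N | j != i) u (i, j).
have [a' [a'n0 a'0]] := dep h.
have [a [[i ai] a0]] := dependent_primitive y0 a'n0 a'0.
have Uh : val_units (f i) (h i).
  apply: big_ind; [exact: val_units1 | exact: val_unitsM | move=> j ji].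
  have [] // := uP (i, j).
  by move=> /= ij; rewrite ij eqxx in ji.
have Mh (j : 'I_N) : j != i -> max_ideal (f i) (h j).
  move=> ji; rewrite /h (bigD1 i) 1?eq_sym //= mulrC; apply: max_idealM; last first.
    by have [] // := uP (j, i); move=> /= ij; rewrite ij eqxx in ji.
  apply: val_ring_prod => k /andP[kj _].
  have [|_ _] := uP (j, k); first by move=> /= jk; rewrite jk eqxx in kj.
  by apply; apply: max_ideal_ring.
suff Mrest : max_ideal (f i) (\sum_(j < N | j != i) ev iota y (a j) * h j).
  have := val_unitsD (val_unitsM (ev_unit (Mf i) ai) Uh) Mrest.
  have -> : ev iota y (a i) * h i +
      \sum_(j < N | j != i) ev iota y (a j) * h j = 0.
    by rewrite -[RHS]a0 [RHS](bigD1 i).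
  by move/val_units_neq0; rewrite eqxx.
apply: max_ideal_sum => j /Mh; apply: max_idealM.
exact/val_ring_ev/max_ideal_ring.
Qed.

(** Multiplies high powers of functions that separate P from the finitely many
    other zeros of y. *)
Lemma other_zeros_killer P y r : y != 0 -> max_ideal P y ->
  exists u, [/\ val_units P u, forall R : place iota, val_ring R y -> val_ring R u
    & forall Q : place iota, Q <> P -> max_ideal Q y -> val_ring Q (u / y ^+ r)].
Proof.
move=> y0 My.
have /choice[v vP] : forall Q, exists v, [/\ val_units P v,
    forall R, val_ring R y -> val_ring R v
    & Q <> P -> max_ideal Q y -> val_ring Q (v / y ^+ r)].
  move=> Q; case: (pselect (Q <> P /\ max_ideal Q y)) => [[QP MQ]|nQ]; last first.
    exists 1; split=> [|R _|QP MQ]; [exact: val_units1 | exact: val_ring1 |].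
    by case: nQ.
  have [u [Uu Mu ureg]] :=
    regular_separation y0 My (max_ideal_ring MQ) (nesym QP).
  have [k Ok] := val_archimedean_mul hF (y ^- r) (val_units_neq0 Uu) Mu.
  exists (u ^+ k); split=> [|R /ureg|_ _]; [exact: val_unitsX | exact: val_ringX |].
  by rewrite mulrC.
have /cardinality.finite_seqP[s sE] := finite_zeros y0.
exists (\prod_(Q <- s) v Q); split.
- apply: big_ind => [|w w'|Q _]; [exact: val_units1 | exact: val_unitsM |].
  by case: (vP Q).
- by move=> R OR; apply: val_ring_prod => Q _; have [_ reg _] := vP Q; apply: reg.
move=> Q QP MQ.
have Qs : Q \in s by have : [set Q | max_ideal Q y] Q := MQ; rewrite sE.
rewrite (big_rem Q) //= mulrAC; apply: val_ringM.
  by case: (vP Q) => _ _; apply.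
apply: val_ring_prod => R _; have [_ reg _] := vP R.
exact/reg/max_ideal_ring.
Qed.

End Approximation.

(** * Functions with a single pole *)

Section SinglePole.

Context (K F : fieldType) (iota : {rmorphism K -> F}).
Context (hF : function_field iota) (hK : full_constant_field iota).
Implicit Types (P Q : place iota) (z t u w x : F).

Lemma ev_eq0 x p : (forall a, x <> iota a) -> ev iota x p = 0 -> p = 0.
Proof.
move=> xK px; apply/eqP; apply: contrapT => /negP p0.
have [|a xa] := hK (z := x); last exact: (xK a).
by exists p => //; apply/eqP.
Qed.

(** Multiplication of a relation over K[x] by a power of x^-1 turns it into
    one over K[x^-1], with the coefficients reversed. *)
Lemma dependence_bound_inv x N : x != 0 ->
  dependence_bound iota x N -> dependence_bound iota x^-1 N.
Proof.
move=> x0 dep f; have [a [[i ai] a0]] := dep f.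
pose D := \max_i size (a i).
have sa j : (size (a j) <= D)%N by apply: leq_bigmax.
pose b j := \poly_(k < D) (a j)`_(D - k.+1).
have bE j : ev iota x^-1 (b j) = ev iota x (a j) * (x^-1 ^+ D * x).
  rewrite (ev_wide _ _ (size_poly _ _)) (ev_wide _ _ (sa j)) mulr_suml.
  rewrite [RHS](reindex_inj rev_ord_inj) /=; apply: eq_bigr => k _.
  rewrite coef_poly ltn_ord -mulrA; congr (_ * _).
  have -> : x^-1 ^+ D = x^-1 ^+ (D - k.+1) * x^-1 ^+ k.+1 by rewrite -exprD subnK.
  by rewrite !mulrA -exprMn divff // expr1n mul1r exprSr divfK.
exists b; split; last first.
  under eq_bigr => j _ do rewrite bE mulrAC.
  by rewrite -mulr_suml a0 mul0r.
exists i; rewrite -lead_coef_eq0 in ai; have n0 : (0 < size (a i))%N.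
  by rewrite lt0n size_poly_eq0 -lead_coef_eq0.
apply: contra_neq ai => /polyP/(_ (D - size (a i))%N).
have lt_D : (D - size (a i) < D)%N by have := sa i; lia.
rewrite coef_poly lt_D coef0.
by have -> : (D - (D - size (a i)).+1 = (size (a i)).-1)%N by have := sa i; lia.
Qed.

(** If sum_i a_i(x) w^i = 0 has degree d in w, then
    a_d w = - sum_(i < d) a_i(x) w^(i - d + 1) is regular where the a_i(x)
    are: a pole of w would make the right-hand side regular. At the poles of
    x, a power of x^-1 makes the a_i(x) regular first. *)
Lemma integral_multiple w x : (forall a, x <> iota a) ->
  exists p c, [/\ p != 0,
    forall Q : place iota, val_ring Q x -> val_ring Q (ev iota x p * w)
  & forall Q : place iota, val_ring Q x^-1 ->
      val_ring Q (ev iota x p * w * x^-1 ^+ c)].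
Proof.
move=> xK; have [N dep] := dependence_bound_exists hF x.
have x0 : x != 0 by apply/eqP => x0; apply: (xK 0); rewrite rmorph0.
have [a [[i0 ai0] a0]] := dep (fun i => w ^+ i).
pose d := [arg max_(i > i0 | a i != 0) (i : nat)].
have [ad0 dmax] : a d != 0 /\ forall i, a i != 0 -> (i <= d)%N.
  by rewrite /d; case: arg_maxnP.
have az (i : 'I_N) : (d < i)%N -> a i = 0.
  by move=> lt_di; apply/eqP; apply: contraTT lt_di => /dmax; rewrite -leqNgt.
have key Q s : (forall i, val_ring Q (ev iota x (a i) * s)) ->
    val_ring Q (ev iota x (a d) * w * s).
  move=> Os; case: (pselect (val_ring Q w)) => [Ow|nOw].
    by rewrite mulrAC; apply: val_ringM.
  have OVw := max_ideal_ring (not_ring_inv nOw).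
  have w0 : w != 0 by apply: contra_notN nOw => /eqP->; apply: val_ring0.
  have [dz|dpos] := posnP d.
    have : ev iota x (a d) = 0.
      rewrite -[RHS]a0 (bigD1 d) //= dz expr0 mulr1 big1 ?addr0 // => i id.
      rewrite az ?ev0 ?mul0r // dz lt0n; apply: contra_neq id => i_0.
      by apply: val_inj; rewrite /= dz i_0.
    by move/(ev_eq0 xK) => ad; rewrite ad eqxx in ad0.
  have -> : ev iota x (a d) * w * s =
      - \sum_(i < N | i != d) ev iota x (a i) * s * (w ^+ i * w^-1 ^+ d.-1).
    apply/eqP; rewrite -addr_eq0; apply/eqP.
    transitivity ((\sum_i ev iota x (a i) * w ^+ i) * (s * w^-1 ^+ d.-1)); last first.
      by rewrite a0 mul0r.
    rewrite [in RHS](bigD1 d) //= mulrDl mulr_suml; congr (_ + _).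
      have -> : w ^+ d = w ^+ d.-1 * w by rewrite -exprSr prednK.
      by rewrite exprVn; field; rewrite expf_neq0.
    by apply: eq_bigr => i _; ring.
  apply/val_ringN/val_ring_sum => i id.
  have [lt_id|lt_di|/val_inj i_d] := ltngtP i d; last by rewrite i_d eqxx in id.
    apply: val_ringM => //.
    have -> : d.-1 = (i + (d.-1 - i))%N by lia.
    rewrite exprD mulrA -exprMn divff // expr1n mul1r; exact: val_ringX.
  by rewrite az // ev0 !mul0r; apply: val_ring0.
exists (a d), (\max_i size (a i)); split=> // Q Ox.
  by rewrite -[_ * w]mulr1; apply: key => i; rewrite mulr1; apply: val_ring_ev.
apply: key => i; rewrite (ev_wide _ _ (leqnn _)) mulr_suml.
apply: val_ring_sum => j _; rewrite -mulrA.
apply: val_ringM; first exact: val_ring_const.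
have le_j : (j <= \max_i size (a i))%N.
  apply: ltnW; apply: leq_trans (ltn_ord j) _; exact: (leq_bigmax i).
by rewrite -(subnKC le_j) exprD mulrA -exprMn divff // expr1n mul1r; apply: val_ringX.
Qed.

(** A maximal family independent over K[x], scaled so that it is regular where
    x is; [c] bounds its poles by [c] times the poles of [x]. *)
Lemma integral_basis x : (forall a, x <> iota a) ->
  exists (n : nat) (e : 'I_n.+1 -> F) (c : nat), [/\ dependence_bound iota x n.+2,
    forall a : 'I_n.+1 -> {poly K},
      \sum_i ev iota x (a i) * e i = 0 -> forall i, a i = 0,
    forall (Q : place iota) i, val_ring Q x -> val_ring Q (e i)
  & forall (Q : place iota) i, val_ring Q x^-1 -> val_ring Q (e i * x^-1 ^+ c)].
Proof.
move=> xK; have exN : exists N, `[< dependence_bound iota x N >].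
  by have [N dep] := dependence_bound_exists hF x; exists N; apply/asboolP.
case: (ex_minnP exN) => -[|[|n]] /asboolP dep minN.
- by have [a [[[]]]] := dep (fun=> 0).
- have [a [[i ai]]] := dep (fun=> 1).
  rewrite big_ord1 mulr1 => /(ev_eq0 xK) a0.
  by rewrite ord1 a0 eqxx in ai.
have [e eP] : exists e : 'I_n.+1 -> F, forall a : 'I_n.+1 -> {poly K},
    \sum_i ev iota x (a i) * e i = 0 -> forall i, a i = 0.
  apply: contrapT => noe; suff /asboolP/minN : dependence_bound iota x n.+1.
    by rewrite ltnn.
  move=> f; apply: contrapT => nof; apply: noe; exists f => a a0 i.
  apply/eqP; apply: contrapT => /negP ai; apply: nof; exists a; split=> //.
  by exists i.
have /choice[p /choice[c pc]] := fun i => integral_multiple (e i) xK.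
exists n, (fun i => ev iota x (p i) * e i), (\max_i c i); split=> //.
- move=> a a0 i; have [p0 _ _] := pc i.
  have : a i * p i = 0.
    apply: (eP (fun i => a i * p i)); rewrite -[RHS]a0.
    by apply: eq_bigr => j _; rewrite evM mulrA.
  by move/eqP; rewrite mulf_eq0 (negPf p0) orbF => /eqP.
- by move=> Q i; have [_ reg _] := pc i; apply: reg.
move=> Q i OV; have [_ _ reg] := pc i.
rewrite -(subnKC (leq_bigmax i : c i <= _)%N) exprD mulrA.
by apply: val_ringM; [apply: reg | apply: val_ringX].
Qed.

Section Filtration.

Context (x : F) (P : place iota).

(** Lowering [k] from [m] to 0 leads from the Riemann-Roch space of [m] times
    the pole divisor of [x] to functions with poles only at [P]. *)
Definition pole_bounded (m k : nat) : set F := [set f |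
  [/\ forall Q : place iota, val_ring Q x -> val_ring Q f,
      val_ring P (f * x^-1 ^+ m)
    & forall Q, Q <> P -> max_ideal Q x^-1 -> val_ring Q (f * x^-1 ^+ k)]].

Lemma val_ring_lin Q a u v s : val_ring Q (u * s) -> val_ring Q (v * s) ->
  val_ring Q ((iota a * u + v) * s).
Proof.
move=> Ou Ov; rewrite mulrDl -mulrA; apply: val_ringD => //.
by apply: val_ringM => //; apply: val_ring_const.
Qed.

Lemma pole_bounded_subspace m k : subspace iota (pole_bounded m k).
Proof.
split.
  by split=> [Q _||Q _ _]; rewrite ?mul0r; apply: val_ring0.
move=> a u v [u1 u2 u3] [v1 v2 v3]; split=> [Q Ox||Q QP MQ].
- by rewrite -[_ + _]mulr1; apply: val_ring_lin; rewrite mulr1; [apply: u1|apply: v1].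
- exact: val_ring_lin.
- by apply: val_ring_lin; [apply: u3|apply: v3].
Qed.

(** Let g = u x^m with u a unit at P that vanishes to high order at the other
    poles of x. Given n + 1 functions f_i in the larger space, the n + 2
    functions f_i and g satisfy a primitive relation over K[x^-1]. The linear
    combination G that its constant terms form is divisible by x^-1. At P this
    forces one of the f_i to occur, for g attains the full order m there; at
    the other poles it says that the combination of the f_i alone lies in the
    smaller space, for g is small there. *)
Lemma pole_bounded_codim n m k : x != 0 -> max_ideal P x^-1 ->
    dependence_bound iota x n.+2 ->
  codim_le iota (pole_bounded m k.+1) (pole_bounded m k) n.
Proof.
move=> x0 MP dep; apply: dependent_codim_le; first exact: pole_bounded_subspace.
set y := x^-1 in MP *; have y0 : y != 0 by rewrite invr_eq0.
move=> f Vf; have [u [Uu ureg uz]] := other_zeros_killer hF m y0 MP.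
pose g := u / y ^+ m.
have [a' [a'n0 a'0]] := dependence_bound_inv x0 dep (extend f g).
have [b [bn0 b0]] := dependent_primitive y0 a'n0 a'0.
have /choice[q bE] := fun i => poly_split (b i).
pose be i := (b i)`_0.
pose G := \sum_i iota (be i) * extend f g i.
pose H := \sum_i ev iota y (q i) * extend f g i.
have GH : G = - (y * H).
  apply/eqP; rewrite -addr_eq0 -[X in _ == X]b0 /G /H mulr_sumr -big_split /=.
  apply/eqP/eq_bigr => i _.
  by rewrite [in RHS]bE evD evC evM evX /be; ring.
have OH Q s : val_ring Q y -> (forall i, val_ring Q (extend f g i * s)) ->
    val_ring Q (H * s).
  move=> Oy Os; rewrite mulr_suml; apply: val_ring_sum => i _.
  by rewrite -mulrA; apply: val_ringM => //; apply: val_ring_ev.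
have OHP : val_ring P (H * y ^+ m).
  apply: OH; first exact: max_ideal_ring.
  apply: (@extend_in F (fun z => val_ring P (z * y ^+ m))).
    by move=> i; case: (Vf i).
  by rewrite /g divfK ?expf_neq0 //; apply: val_units_ring.
have GE : G = \sum_j iota (be (lift ord_max j)) * f j + iota (be ord_max) * g.
  exact: extend_sum.
exists (fun j => be (lift ord_max j)); split.
  apply: contrapT => all0.
  have be0 j : be (lift ord_max j) = 0.
    by apply/eqP; apply: contrapT => /negP bej; apply: all0; exists j.
  have bmax : be ord_max != 0.
    have [i bi] := bn0; case: (unliftP ord_max i) bi => [j ->|-> //].
    by rewrite -/(be _) be0 eqxx.
  have : max_ideal P (G * y ^+ m).
    rewrite GH mulNr -mulrA mulrC -mulNr; apply: max_idealM => //.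
    exact: val_ringN.
  rewrite GE big1 => [|j _]; last by rewrite be0 rmorph0 mul0r.
  rewrite add0r -mulrA /g divfK ?expf_neq0 //; apply: val_units_max.
  by apply: val_unitsM => //; apply: val_units_const.
have [S1 S2 _] := subspace_sum (fun j => be (lift ord_max j))
  (pole_bounded_subspace m k.+1) Vf.
split=> // Q QP MQ.
have Oy := max_ideal_ring MQ.
have -> : \sum_i iota (be (lift ord_max i)) * f i = iota (- be ord_max) * g + G.
  by rewrite GE rmorphN mulNr addrC addrK.
apply: val_ring_lin.
  by apply: val_ringM; [apply: uz | apply: val_ringX].
have -> : G * y ^+ k = - (H * y ^+ k.+1) by rewrite GH exprS; ring.
apply/val_ringN/OH => //.
apply: (@extend_in F (fun z => val_ring Q (z * y ^+ k.+1))).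
  by move=> i; have [_ _] := Vf i; apply.
by apply: val_ringM; [apply: uz | apply: val_ringX].
Qed.

Lemma codim_le_refl (V : set F) : codim_le iota V V 0.
Proof.
exists 'I_0, (fun=> 0); split; first by rewrite card_ord.
by move=> z Vz; exists (fun=> 0); rewrite big_ord0 subr0.
Qed.

Lemma pole_bounded_codim0 n m k : x != 0 -> max_ideal P x^-1 ->
    dependence_bound iota x n.+2 ->
  codim_le iota (pole_bounded m k) (pole_bounded m 0) (k * n).
Proof.
move=> x0 MP dep; elim: k => [|k IH]; first exact: codim_le_refl.
by rewrite mulSn; apply: codim_le_trans IH; apply: pole_bounded_codim.
Qed.

End Filtration.

(** If only constants were regular outside of P, the functions with poles
    bounded by m times those of x would have dimension at most m n + 1, where
    n + 1 is the rank of F over K(x). But this space contains the x^l e_i with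
    l + c <= m, whose number grows like m (n + 1). *)
Lemma exists_single_pole P : exists y, (forall a, y <> iota a) /\
  forall Q, Q <> P -> val_ring Q y.
Proof.
have [t t0 Mt] := max_ideal_neq0 P; pose x := t^-1.
have MP : max_ideal P x^-1 by rewrite invrK.
have x0 : x != 0 by rewrite invr_eq0.
have xK a : x <> iota a.
  move=> xa; apply: (max_ideal_inv t0 Mt); rewrite -/x xa.
  exact: val_ring_const.
have [n [e [c [dep indep eaff epole]]]] := integral_basis xK.
apply: contrapT => noy.
(* With these values L * n.+1 exceeds m * n + 1. *)
pose L := (c * n).+2; pose m := (c + L)%N.
have small : codim_le iota (pole_bounded x P m m) [set 0] (m * n + 1).
  apply: codim_le_trans (pole_bounded_codim0 m m x0 MP dep) _.
  exists unit, (fun=> 1); rewrite card_unit; split=> // f [f1 f2 f3].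
  have [a fa] : exists a, f = iota a.
    apply: contrapT => nofa; apply: noy; exists f; split=> [a fa|Q QP].
      by apply: nofa; exists a.
    case: (pselect (val_ring Q x)) => [/f1 //|/not_ring_inv MQ].
    by have := f3 Q QP MQ; rewrite expr0 mulr1.
  by exists (fun=> a); rewrite /= (big_pred1 tt) ?mulr1 ?fa ?subrr // => -[].
have [|[i l]|a [[[i l] ail] a0]] := @codim_le_dependent _ _ _ _ _
    ('I_n.+1 * 'I_L)%type (fun il => x ^+ il.2 * e il.1) small.
- by rewrite card_prod !card_ord /m /L; nia.
- have pole Q : val_ring Q x^-1 -> val_ring Q (x ^+ l * e i * x^-1 ^+ m).
    move=> OV; have lL : (l <= L)%N by apply: ltnW.
    have -> : m = (c + l + (L - l))%N by rewrite /m; lia.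
    have -> : x ^+ l * e i * x^-1 ^+ (c + l + (L - l)) =
        e i * x^-1 ^+ c * x^-1 ^+ (L - l).
      by rewrite !exprD [x^-1 ^+ l]exprVn; field; rewrite !expf_neq0.
    by apply: val_ringM; [apply: epole | apply: val_ringX].
  split=> [Q Ox||Q _ /max_ideal_ring/pole//].
    by apply: val_ringM; [apply: val_ringX | apply: eaff].
  exact/pole/max_ideal_ring.
suff /(_ i)/polyP/(_ l) : forall i, \poly_(l < L) a (i, inord l) = 0.
  by rewrite coef_poly ltn_ord coef0 inord_val => ail0; rewrite ail0 eqxx in ail.
apply: indep; rewrite -[RHS]a0.
transitivity (\sum_i \sum_(l < L) iota (a (i, l)) * (x ^+ l * e i)); last first.
  by rewrite pair_bigA; apply: eq_bigr => -[].
apply: eq_bigr => j _; rewrite (ev_wide _ _ (size_poly _ _)) mulr_suml.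
by apply: eq_bigr => k _; rewrite coef_poly ltn_ord inord_val mulrA.
Qed.

End SinglePole.

(** * Prescribed pole orders and Riemann-Roch spaces *)

Section RiemannRoch.

Context (K F : fieldType) (iota : {rmorphism K -> F}).
Context (hF : function_field iota) (hK : full_constant_field iota).
Implicit Types (P Q : place iota) (z t u w : F) (D : {freeg place iota}).

(** Take y with poles only at P2 and a zero at P1, of order e. The function is
    b w u / y^s with v_P1(w) = e s - s, where b makes b w regular outside of
    P2 and u cancels the zeros of y^s other than P1; both are units at P1. *)
Lemma exists_pole_order P1 P2 (s : nat) : rational P1 -> P1 <> P2 ->
  exists f, [/\ f != 0, valuation P1 f = - s%:Z &
    forall Q, Q <> P1 -> Q <> P2 -> val_ring Q f].
Proof.
move=> ratP1 P12; have [y' [y'K y'reg]] := exists_single_pole hF hK P2.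
have [c My] := rational_residue ratP1 (y'reg P1 P12).
set y := y' - iota c in My.
have y0 : y != 0 by apply/eqP => /subr0_eq; apply: y'K.
have yreg Q : Q <> P2 -> val_ring Q y.
  by move=> QP2; apply: val_ringB; [apply: y'reg | apply: val_ring_const].
have vy : 0 < valuation P1 y by apply/max_ideal_valuation.
pose n := valuation P1 y *+ s - s%:Z.
have [w w0 [vw _]] := order_geE hF P1 n.
have Ow : val_ring P1 w.
  apply/(val_ring_valuation hF) => //; rewrite vw /n subr_ge0 -mulr_natr.
  by rewrite natz ler_peMl.
have [b Ub breg] := local_denominator hF y0 My Ow.
have [u [Uu ureg uz]] := other_zeros_killer hF s y0 My.
have b0 := val_units_neq0 Ub; have u0 := val_units_neq0 Uu.
have ys0 : y ^- s != 0 by rewrite invr_eq0 expf_neq0.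
have vU v (U : val_units P1 v) : valuation P1 v = 0.
  by apply/(val_units_valuation hF) => //; apply: val_units_neq0 U.
exists (b * w * (u * y ^- s)); split.
- by rewrite !mulf_neq0.
- rewrite !valuationM ?mulf_neq0 // vw (vU _ Ub) (vU _ Uu).
  by rewrite valuationV ?expf_neq0 // valuationX // /n; ring.
- move=> Q QP1 QP2; have Oy := yreg Q QP2.
  apply: val_ringM; first by have [] := breg Q Oy.
  have [[_ _ OVy]|MQ] := unit_or_max Oy; last exact: uz.
  by apply: val_ringM; [apply: ureg | rewrite -exprVn; apply: val_ringX].
Qed.

Lemma RR_spaceE D z : RR_space D z <-> forall Q, order_ge Q (- coeff Q D) z.
Proof.
rewrite /RR_space /order_ge /=; split=> [[->|H] Q|H]; first by rewrite eqxx.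
  by rewrite -subr_ge0 opprK.
have [|z0] := eqVneq z 0; first by left.
by right=> Q; have := H Q z0; rewrite -subr_ge0 opprK.
Qed.

Lemma RR_space_subspace D : subspace iota (RR_space D).
Proof.
split; first by left.
move=> a u v /RR_spaceE Du /RR_spaceE Dv; apply/RR_spaceE => Q.
by have [_] := order_ge_subspace hF Q (- coeff Q D); apply.
Qed.

Lemma RR_spaceB1 D P z : RR_space (D - << P >>) z <->
  RR_space D z /\ (z != 0 -> - coeff P D < valuation P z).
Proof.
have cE Q : coeff Q (D - << P >>) = coeff Q D - (P == Q)%:R.
  by rewrite coeffB coeffU mul1r.
rewrite !RR_spaceE; split=> [H|[H HP] Q].
  split=> [Q z0|z0].
    by have := H Q z0; rewrite cE; case: (P == Q) => /=; lia.
  by have := H P z0; rewrite cE eqxx /=; lia.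
move=> z0; rewrite cE; have := H Q z0; case: eqP => [<-|_] /=; last by lia.
by have := HP z0; lia.
Qed.

(** If g has the extreme order allowed by D at P, any other element of the
    space is moved into the smaller space by a constant multiple of g. If
    there is no such g, the two spaces agree. *)
Lemma RR_space_codim1 D P : rational P ->
  codim_le iota (RR_space D) (RR_space (D - << P >>)) 1.
Proof.
move=> ratP.
case: (pselect (exists g, [/\ g != 0, RR_space D g & valuation P g = - coeff P D])).
  move=> [g [g0 Dg vg]]; exists unit, (fun=> g); rewrite card_unit; split=> // z Dz.
  have Ozg : val_ring P (z / g).
    have [->|z0] := eqVneq z 0; first by rewrite mul0r; apply: val_ring0.
    apply/(valuation_le hF) => //; rewrite vg.
    by have /RR_spaceE/(_ P z0) := Dz.
  have [c Mc] := rational_residue ratP Ozg.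
  exists (fun=> c); rewrite (big_pred1 tt) => [|[]] //=.
  apply/RR_spaceB1; split.
    have sD := RR_space_subspace D.
    exact: (subspaceB sD Dz (subspace_scale c sD Dg)).
  move=> n0; rewrite -vg; apply/(valuation_lt hF) => //.
  by rewrite mulrBl mulfK.
move=> nog; exists void, (fun=> 0); rewrite card_void; split=> // z Dz.
exists (fun=> 0); rewrite big_pred0 ?subr0 => [|[]] //.
apply/RR_spaceB1; split=> // z0; rewrite lt_neqAle.
have /RR_spaceE/(_ P z0) /= -> := Dz; rewrite andbT.
by apply/eqP => vz; apply: nog; exists z.
Qed.

(** Each of the a + b points adds at most one dimension to the space of
    everywhere regular functions, which are the constants. *)
Lemma RR_space_finite P1 P2 (a b : nat) : rational P1 -> rational P2 ->
  codim_le iota (RR_space (<< P1 >> *+ a + << P2 >> *+ b)) [set 0] (a + b + 1).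
Proof.
move=> rat1 rat2; elim: a => [|a IH].
  rewrite mulr0n add0r add0n; elim: b => [|b IH].
    rewrite mulr0n; exists unit, (fun=> 1); rewrite card_unit; split=> // f Df.
    have [c fc] : exists c, f = iota c.
      apply: contrapT => noc.
      have [|Q nO] := exists_place_pole hK (z := f).
        by move=> c fc; apply: noc; exists c.
      apply: nO; have [->|f0] := eqVneq f 0; first exact: val_ring0.
      apply/(val_ring_valuation hF) => //.
      by have /RR_spaceE/(_ Q f0) := Df; rewrite coeff0 oppr0.
    by exists (fun=> c); rewrite (big_pred1 tt) => [|[]] //=; rewrite mulr1 fc subrr.
  have -> : (b.+1 + 1 = 1 + (b + 1))%N by lia.
  apply: codim_le_trans IH; rewrite mulrSr.
  rewrite -[X in codim_le _ _ (RR_space X)](addrK << P2 >>).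
  exact: RR_space_codim1.
have -> : (a.+1 + b + 1 = 1 + (a + b + 1))%N by lia.
apply: codim_le_trans IH; rewrite mulrSr addrAC.
rewrite -[X in codim_le _ _ (RR_space X)](addrK << P1 >>).
exact: RR_space_codim1.
Qed.

(** The two spaces are equal if and only if no function attains the order that
    D allows at P; finiteness turns equality of dimensions into equality of
    spaces. *)
Lemma ell_drop D P n : codim_le iota (RR_space D) [set 0] n ->
  ell D = ell (D - << P >>) <->
  forall z, z != 0 -> RR_space D z -> valuation P z <> - coeff P D.
Proof.
move=> Dn; have sub : RR_space (D - << P >>) `<=` RR_space D.
  by move=> z /RR_spaceB1[].
split=> [ellE z z0 Dz vz|noz].
  have /RR_spaceB1[_ /(_ z0)] :=
    eq_quotient_dim_sub (RR_space_subspace _) sub Dn ellE Dz.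
  by rewrite vz ltxx.
rewrite /ell; congr quotient_dim; apply/seteqP; split=> // z Dz.
apply/RR_spaceB1; split=> // z0; rewrite lt_neqAle.
have /RR_spaceE/(_ P z0) /= -> := Dz; rewrite andbT.
by apply/eqP => vz; apply: (noz z z0 Dz).
Qed.

End RiemannRoch.

(** * From pole numbers to pure gaps *)

(** The combinatorial core: a relation [H] on natural numbers that admits
    cancellation in both directions determines its pure gaps from the least
    partners [m a]. *)
Lemma pure_glb_iff (H : nat -> nat -> Prop) (m : nat -> nat) :
    H 0 0 ->
    (forall b, exists a, H a b) ->
    (forall a b b', H a b -> H a b' -> b' < b -> 0 < a ->
       exists2 a', a' < a & H a' b)%N ->
    (forall a a' b, H a b -> H a' b -> a' < a -> 0 < b ->
       exists2 b', b' < b & H a b')%N ->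
    (forall a, H a (m a) /\ forall b, H a b -> m a <= b)%N ->
  forall s t,
    ((forall b, b <= t -> ~ H s b) /\ (forall a, a <= s -> ~ H a t))%N <->
    (exists a b, [/\ ~ H a 0, ~ H b 0, minn a b = s & minn (m a) (m b) = t])%N /\
    ~ (~ H s 0 /\ m s = t).
Proof.
move=> H00 H2 X1 X2 mP s t; split=> [[noS noT]|[[a [b [na nb <- <-]]] nG]].
  have lt_tm : (t < m s)%N.
    by rewrite ltnNge; apply/negP => le_mt; apply: (noS _ le_mt); case: (mP s).
  have exa : exists a, `[< H a t >] by have [a Ha] := H2 t; exists a; apply/asboolP.
  case: (ex_minnP exa) => b /asboolP Hbt minb.
  have lt_sb : (s < b)%N.
    by rewrite ltnNge; apply/negP => le_bs; apply: (noT _ le_bs).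
  have t0 : (0 < t)%N.
    by rewrite lt0n; apply/eqP => t0; apply: (noT 0%N) => //; rewrite t0.
  have b0 : (0 < b)%N by apply: leq_ltn_trans lt_sb.
  have noless t' : H b t' -> ~ (t' < t)%N.
    move=> Hbt' lt_t; have [b' lt_b /asboolP/minb] := X1 _ _ _ Hbt Hbt' lt_t b0.
    by rewrite leqNgt lt_b.
  have mb : m b = t.
    have [Hm /(_ _ Hbt)] := mP b; rewrite leq_eqVlt => /orP[/eqP //|].
    by move/(noless _ Hm).
  split.
    exists s, b; split; [exact: noS | by move/noless; apply | |].
      exact/minn_idPl/ltnW.
    by rewrite mb; apply/minn_idPr/ltnW.
  by case=> _ mt; rewrite mt ltnn in lt_tm.
wlog le_ab : a b na nb nG / (a <= b)%N => [hwlog|].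
  have /orP[le_ab|le_ba] := leq_total a b; first exact: (hwlog a b).
  rewrite minnC (minnC (m a)) in nG *; exact: (hwlog b a).
have aE := minn_idPl le_ab; rewrite aE in nG *.
have lt_m : (m b < m a)%N.
  rewrite ltnNge; apply/negP => le_m; apply: nG; split=> //.
  by rewrite (minn_idPl le_m).
have lt_ab : (a < b)%N.
  rewrite ltn_neqAle le_ab andbT; apply: contraTneq lt_m => ->; by rewrite ltnn.
rewrite (minn_idPr (ltnW lt_m)).
split=> [c le_c Hac|c le_c Hcm].
  have [_ /(_ _ Hac)] := mP a; lia.
have [Hm minm] := mP b.
have mb0 : (0 < m b)%N.
  by rewrite lt0n; apply/eqP => mb0; apply: nb; rewrite -mb0.
have [c' lt_c' /minm] := X2 _ _ _ Hm Hcm (leq_ltn_trans le_c lt_ab) mb0.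
by rewrite leqNgt lt_c'.
Qed.

Section PoleNumbers.

Context (K F : fieldType) (iota : {rmorphism K -> F}).
Context (hF : function_field iota) (hK : full_constant_field iota).
Implicit Types (P Q : place iota) (z : F) (D : {freeg place iota}).

Lemma coeff_two_points P1 P2 (a b : nat) Q : P1 <> P2 ->
  coeff Q (<< P1 >> *+ a + << P2 >> *+ b : {freeg place iota}) =
    if Q == P1 then a%:Z else if Q == P2 then b%:Z else 0.
Proof.
move=> P12; rewrite coeffD !coeffMn !coeffU !mul1r (eq_sym P1) (eq_sym P2).
have [->|_] := eqVneq Q P1.
  by rewrite (introF eqP P12) /= mul0rn addr0 natz.
by case: (Q == P2); rewrite mul0rn add0r ?natz ?mul0rn.
Qed.

Lemma weierstrass2C P1 P2 a b :
  weierstrass2 P1 P2 (a, b) <-> weierstrass2 P2 P1 (b, a).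
Proof. by rewrite /weierstrass2 /= addrC. Qed.

Lemma weierstrass1E P1 P2 s : weierstrass1 P1 s <-> weierstrass2 P1 P2 (s, 0%N).
Proof. by rewrite /weierstrass1 /weierstrass2 /= mulr0n addr0. Qed.

Lemma weierstrass2P P1 P2 (a b : nat) : P1 <> P2 ->
  weierstrass2 P1 P2 (a, b) <->
  exists z, [/\ z != 0, a%:Z = Num.max 0 (- valuation P1 z),
    b%:Z = Num.max 0 (- valuation P2 z)
    & forall Q, Q <> P1 -> Q <> P2 -> val_ring Q z].
Proof.
move=> P12; split=> [[z [z0 zP]]|[z [z0 v1 v2 vQ]]]; exists z.
  have := zP P1; have := zP P2; rewrite /= !coeff_two_points // !eqxx.
  rewrite (introF eqP (nesym P12)) => v2 v1; split=> //.
  move=> Q /eqP/negPf QP1 /eqP/negPf QP2; apply/(val_ring_valuation hF) => //.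
  by have := zP Q; rewrite /= coeff_two_points // QP1 QP2; lia.
split=> // Q; rewrite /= coeff_two_points //.
have [->|QP1] := eqVneq Q P1; first by [].
have [->|QP2] := eqVneq Q P2; first by [].
have /(val_ring_valuation hF Q z0) : val_ring Q z by apply: vQ; apply/eqP.
lia.
Qed.

Lemma weierstrass2_intro P1 P2 (a b : nat) z : P1 <> P2 -> z != 0 ->
    valuation P1 z = - a%:Z -> - b%:Z <= valuation P2 z ->
    (forall Q, Q <> P1 -> Q <> P2 -> val_ring Q z) ->
  exists2 b', (b' <= b)%N & weierstrass2 P1 P2 (a, b').
Proof.
move=> P12 z0 v1 v2 vQ; exists (absz (Num.max 0 (- valuation P2 z))); first by lia.
by apply/(weierstrass2P _ _ P12); exists z; split=> //; lia.
Qed.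

Lemma weierstrass2_00 P1 P2 : P1 <> P2 -> weierstrass2 P1 P2 (0, 0)%N.
Proof.
move=> P12; exists 1; split=> [|Q]; first exact: oner_neq0.
by rewrite valuation1 //= coeff_two_points //; do 2?case: ifP.
Qed.

Lemma weierstrass2_exists P1 P2 a : P1 <> P2 -> rational P1 ->
  exists b, weierstrass2 P1 P2 (a, b).
Proof.
move=> P12 rat1; have [f [f0 vf fQ]] := exists_pole_order hF hK a rat1 P12.
have [||b' _ Hb] := @weierstrass2_intro P1 P2 a (absz (valuation P2 f)) f P12 f0 vf.
- by lia.
- exact: fQ.
by exists b'.
Qed.

(** For functions f, g with poles (a, b), (a, b'), a suitable f - c g has a
    smaller pole at P1, and it keeps the pole of f at P2 because b' < b. *)
Lemma weierstrass2_cancel P1 P2 a b b' : P1 <> P2 -> rational P1 ->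
    weierstrass2 P1 P2 (a, b) -> weierstrass2 P1 P2 (a, b') -> (b' < b)%N ->
    (0 < a)%N ->
  exists2 a', (a' < a)%N & weierstrass2 P1 P2 (a', b).
Proof.
move=> P12 rat1 /(weierstrass2P _ _ P12)[f [f0 f1 f2 fQ]].
move=> /(weierstrass2P _ _ P12)[g [g0 g1 g2 gQ]] lt_b a0.
have [|c c1] := rational_cancel hF rat1 f0 g0; first by lia.
have vf2 : valuation P2 f = - b%:Z by lia.
have [h0 h2] : f - iota c * g != 0 /\ valuation P2 (f - iota c * g) = - b%:Z.
  rewrite -vf2; apply: (valuation_addl hF) => //.
  rewrite oppr_eq0 mulf_eq0 negb_or => /andP[c0 _].
  rewrite -mulNr -rmorphN valuationM ?fmorph_eq0 ?oppr_eq0 //; last first.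
    by rewrite fmorph_eq0 in c0.
  rewrite valuation_const ?oppr_eq0 ?add0r //; last by rewrite fmorph_eq0 in c0.
  by rewrite vf2; lia.
have [||a' le_a' H] := @weierstrass2_intro P2 P1 b a.-1 _ (nesym P12) h0 h2.
- have aE : a.-1%:Z = a%:Z - 1 by lia.
  by have := c1 h0; rewrite aE; move: f1 a0;
    set v := valuation P1 _; set w := valuation P1 _; lia.
- move=> Q QP2 QP1; apply: val_ringB; first exact: fQ.
  by apply: val_ringM; [apply: val_ring_const | apply: gQ].
by exists a'; [lia | apply/weierstrass2C].
Qed.

Lemma least_partnerP P1 P2 a : P1 <> P2 -> rational P1 ->
  weierstrass2 P1 P2 (a, least_partner P1 P2 a) /\
  forall b, weierstrass2 P1 P2 (a, b) -> (least_partner P1 P2 a <= b)%N.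
Proof.
move=> P12 rat1; apply: (xgetPex 0%N (P := [set c : nat |
  weierstrass2 P1 P2 (a, c) /\
  forall c' : nat, weierstrass2 P1 P2 (a, c') -> (c <= c')%N])).
have exb : exists b, `[< weierstrass2 P1 P2 (a, b) >].
  by have [b Hb] := weierstrass2_exists a P12 rat1; exists b; apply/asboolP.
case: (ex_minnP exb) => b /asboolP Hb minb; exists b; split=> // c Hc.
exact/minb/asboolP.
Qed.

Lemma ell_drop_iff P1 P2 (a b : nat) : P1 <> P2 -> rational P1 -> rational P2 ->
  let D : {freeg place iota} := << P1 >> *+ a + << P2 >> *+ b in
  ell D = ell (D - << P1 >>) <->
  forall b', (b' <= b)%N -> ~ weierstrass2 P1 P2 (a, b').
Proof.
move=> P12 rat1 rat2 D.
have Dfin := RR_space_finite hF hK a b rat1 rat2.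
rewrite (ell_drop hF P1 Dfin) /= coeff_two_points // eqxx.
split=> [nof b' le_b H|noH z z0].
  have [a0|a0] := posnP a.
    (* Here a pole number only bounds the valuation from below, so the function
       of exact order 0 is taken to be 1. *)
    have D1 : RR_space D 1.
      right=> Q; rewrite valuation1 // add0r coeff_two_points //.
      by do 2?case: ifP.
    by apply: (nof 1 (oner_neq0 _) D1); rewrite valuation1 // a0.
  have [z [z0 z1 z2 zQ]] := (weierstrass2P _ _ P12).1 H.
  apply: (nof z z0); last by lia.
  right=> Q; rewrite coeff_two_points //.
  have [->|QP1] := eqVneq Q P1; first by lia.
  have [->|QP2] := eqVneq Q P2; first by lia.
  by rewrite addr0; apply/(val_ring_valuation hF) => //; apply: zQ; apply/eqP.
move=> /RR_spaceE Dz z1.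
have [||b' le_b'] := weierstrass2_intro (b := b) P12 z0 z1; last exact: noH.
- have := Dz P2 z0; rewrite coeff_two_points // eqxx (introF eqP (nesym P12)).
  by [].
- move=> Q /eqP/negPf QP1 /eqP/negPf QP2; apply/(val_ring_valuation hF) => //.
  by have := Dz Q z0; rewrite coeff_two_points // QP1 QP2 oppr0.
Qed.

Lemma pure_gapsE P1 P2 : P1 <> P2 -> rational P1 -> rational P2 ->
  forall s t, pure_gaps P1 P2 (s, t) <->
    ((forall b, b <= t -> ~ weierstrass2 P1 P2 (s, b)) /\
     (forall a, a <= s -> ~ weierstrass2 P1 P2 (a, t)))%N.
Proof.
move=> P12 rat1 rat2 s t; rewrite /pure_gaps /= (ell_drop_iff _ _ P12 rat1 rat2).
rewrite addrC (ell_drop_iff _ _ (nesym P12) rat2 rat1).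
by split=> -[H1 H2]; split=> // a le_a /weierstrass2C; apply: H2.
Qed.

End PoleNumbers.

Theorem proposition3p3 (K : finFieldType) (F : fieldType)
    (iota : {rmorphism K -> F})
    (hF : function_field iota) (hK : full_constant_field iota)
    (P1 P2 : place iota) (hP1 : rational P1) (hP2 : rational P2)
    (hP12 : P1 <> P2) :
  pure_gaps P1 P2 =
    [set glb x y | x in min_gen_set P1 P2 & y in min_gen_set P1 P2]
      `\` min_gen_set P1 P2.
Proof.
have gapE a : gaps1 P1 a <-> ~ weierstrass2 P1 P2 (a, 0%N).
  by rewrite /gaps1 /setC /= (weierstrass1E P1 P2).
have pureE : forall s t, pure_gaps P1 P2 (s, t) <->
    (exists a b, [/\ gaps1 P1 a, gaps1 P1 b, minn a b = s
      & minn (least_partner P1 P2 a) (least_partner P1 P2 b) = t]) /\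
    ~ (gaps1 P1 s /\ least_partner P1 P2 s = t).
  move=> s t; rewrite (pure_gapsE hF hK) // gapE.
  rewrite (@pure_glb_iff (fun a b => weierstrass2 P1 P2 (a, b))
    (least_partner P1 P2)).
  - by split=> -[[a [b [na nb min1 min2]]] nG]; split=> //;
      exists a, b; split=> //; apply/gapE.
  - exact: weierstrass2_00.
  - move=> b; have [a] := weierstrass2_exists hF hK b (nesym hP12) hP2.
    by move/weierstrass2C; exists a.
  - by move=> a b b'; apply: weierstrass2_cancel.
  - move=> a a' b /weierstrass2C Hab /weierstrass2C Hab' lt_a b0.
    have [b' lt_b /weierstrass2C Hab''] :=
      weierstrass2_cancel hF (nesym hP12) hP2 Hab Hab' lt_a b0.
    by exists b'.
  - by move=> a; apply: least_partnerP.
have genE s t : min_gen_set P1 P2 (s, t) <->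
    gaps1 P1 s /\ least_partner P1 P2 s = t.
  by split=> [[a ga [<- <-]]|[gs <-]] //; exists s.
apply/seteqP; split=> -[s t].
  case/pureE => -[a [b [ga gb <- <-]]] nG; split; last by rewrite genE.
  exists (a, least_partner P1 P2 a); first by apply/genE.
  by exists (b, least_partner P1 P2 b) => //; apply/genE.
case=> -[x xG [y yG glbE]] nG; apply/pureE; split; last by rewrite -genE.
move: x y xG yG glbE => [a c] [b d] /genE[ga <-] /genE[gb <-] [<- <-].
by exists a, b.
Qed.
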